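(* Let $k\ge2$ and let $M$ be a $C^k$-partitionable smooth manifold modelled on a Banach space. If $\pi_k:T^kM\to M$ admits a vector bundle structure isomorphic to $\oplus_{i=1}^kTM$, then a linear connection on $M$ can be defined.
   Context: Let $M$ be modelled on the Banach space $\mathbb{E}$ with atlas $\{(U_\alpha,\psi_\alpha)\}_{\alpha\in I}$. $M$ is $C^k$-partitionable if every open cover of $M$ admits a subordinate $C^k$ partition of unity. For $x_0\in M$ let $C_{x_0}$ be the set of smooth curves $\gamma:(-\epsilon,\epsilon)\to M$ with $\gamma(0)=x_0$; $\gamma_1\approx^k_{x_0}\gamma_2$ iff $\gamma_1^{(j)}(0)=\gamma_2^{(j)}(0)$ for $1\le j\le k$ (in a chart). $T^kM=\bigcup_{x\in M}C_x/\approx^k_x$, the class of $\gamma$ is $[\gamma,x]_k$, and $\pi_k:T^kM\to M$, $[\gamma,x]_k\mapsto x$. $T^kM$ carries the smooth manifold structure (modelled on $\mathbb{E}^{k+1}$), making $\pi_k$ a smooth fibre bundle, with charts $\Psi_\alpha^k:\pi_k^{-1}(U_\alpha)\to\psi_\alpha(U_\alpha)\times\mathbb{E}^k$, $[\gamma,x]_k\mapsto\big((\psi_\alpha\circ\gamma)(0),(\psi_\alpha\circ\gamma)'(0),\dots,\frac1{k!}(\psi_\alpha\circ\gamma)^{(k)}(0)\big)$. A vector bundle structure on $\pi_k:T^kM\to M$ is a smooth Banach vector bundle structure over $M$ on the manifold $T^kM$ with projection $\pi_k$ (compatible with the smooth manifold structure on $T^kM$ given by the charts $(\pi_k^{-1}(U_\alpha),\Psi_\alpha^k)$,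 $\alpha\in I$). It is isomorphic to $\oplus_{i=1}^kTM$ if it is isomorphic, as a smooth vector bundle over $M$ (covering the identity of $M$), to the Whitney sum of $k$ copies of $TM$. A linear connection on $M$ is given by local components $\Gamma_\alpha$, $\alpha\in I$: smooth maps $\psi_\alpha(U_\alpha)\to L^2(\mathbb{E},\mathbb{E};\mathbb{E})$ into the continuous bilinear maps, written $(x;\xi,y)\mapsto\Gamma_\alpha(x,\xi)y$, such that on overlaps, with $\psi_{\beta\alpha}=\psi_\beta\circ\psi_\alpha^{-1}$, $d\psi_{\beta\alpha}(x)[\Gamma_\alpha(x,\xi)y]=d^2\psi_{\beta\alpha}(x)(\xi,y)+\Gamma_\beta\big(\psi_{\beta\alpha}(x),d\psi_{\beta\alpha}(x)\xi\big)\,d\psi_{\beta\alpha}(x)y$. *)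

(* Defs.v *)
From HB Require Import structures.
From mathcomp Require Import all_boot all_order all_algebra.
From mathcomp Require Import all_classical all_reals all_analysis.

Set Implicit Arguments.
Unset Strict Implicit.
Unset Printing Implicit Defensive.

Import Order.TTheory GRing.Theory Num.Theory.
Import numFieldNormedType.Exports.

Local Open Scope classical_set_scope.
Local Open Scope ring_scope.

Section ContinuousLinearMaps.
Variables (R : realType) (E F : normedModType R).

Definition clin_pred : {pred (E -> F)} :=
  [pred f : E -> F | `[< linear f /\ continuous f >]].

Lemma clin_predP (f : E -> F) :
  reflect (linear f /\ continuous f) (f \in clin_pred).
Proof. exact: asboolP. Qed.

Lemma clin_submod_closed : submod_closed clin_pred.
Proof.
split.
  apply/clin_predP; split => [a u v|]; last exact: cst_continuous.
  by rewrite -[RHS]/(a *: 0 + 0) scaler0 addr0.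
move=> a f g /clin_predP[lf cf] /clin_predP[lg cg]; apply/clin_predP; split.
  move=> b u v; rewrite -[LHS]/(a *: f _ + g _).
  rewrite -[RHS]/(b *: (a *: f u + g u) + (a *: f v + g v)) lf lg.
  rewrite !scalerDr !scalerA (mulrC a b) -!addrA; congr (_ + _).
  by rewrite addrCA.
move=> x; apply: (@continuousD R F E (fun y => a *: f y) g x); last exact: cg.
by apply: continuousZl_tmp; exact: cf.
Qed.

HB.instance Definition _ :=
  GRing.isSubmodClosed.Build R (E -> F) clin_pred clin_submod_closed.

Record clin := CLin { clin_fun :> E -> F; clinP : clin_fun \in clin_pred }.

HB.instance Definition _ := [isSub for clin_fun].
HB.instance Definition _ := [Choice of clin by <:].
HB.instance Definition _ := [SubChoice_isSubLmodule of clin by <:].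

Lemma clin_linear (f : clin) : linear f.
Proof. by case/clin_predP: (clinP f). Qed.

Lemma clin_continuous (f : clin) : continuous f.
Proof. by case/clin_predP: (clinP f). Qed.

HB.instance Definition _ (f : clin) :=
  GRing.isLinear.Build R E F *:%R (clin_fun f) (clin_linear f).

Lemma clinDE (f g : clin) x : (f + g) x = f x + g x.
Proof. by []. Qed.

Lemma clinZE a (f : clin) x : (a *: f) x = a *: f x.
Proof. by []. Qed.

Definition opnorm (f : clin) : R := sup [set `|f x| | x in [set x | `|x| <= 1]].

Lemma opnorm_has_sup (f : clin) :
  has_sup [set `|f x| | x in [set x | `|x| <= 1]].
Proof.
split; first by exists `|f 0|; exists 0 => //=; rewrite normr0 ler01.
have /linear_boundedP : bounded_near f (nbhs 0).
  exact/linear_bounded_continuous/clin_continuous.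
move=> /pinfty_ex_gt0[r r0 fr]; exists r => _ [x /= x1 <-].
by rewrite (le_trans (fr x))// ler_piMr// ltW.
Qed.

Lemma opnorm_ub (f : clin) x : `|x| <= 1 -> `|f x| <= opnorm f.
Proof. by move=> x1; apply: ub_le_sup; [case: (opnorm_has_sup f)|exists x]. Qed.

Lemma opnorm_le_ub (f : clin) r :
  (forall x, `|x| <= 1 -> `|f x| <= r) -> opnorm f <= r.
Proof.
move=> fr; apply: ge_sup; first by case: (opnorm_has_sup f).
by move=> _ [x /= x1 <-]; exact: fr.
Qed.

Lemma opnorm_ge0 (f : clin) : 0 <= opnorm f.
Proof. by rewrite (le_trans _ (@opnorm_ub f 0 _)) ?normr0 ?ler01. Qed.

Lemma opnormD (f g : clin) : opnorm (f + g) <= opnorm f + opnorm g.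
Proof.
apply: opnorm_le_ub => x x1; rewrite clinDE (le_trans (ler_normD _ _))//.
by rewrite lerD// opnorm_ub.
Qed.

Lemma opnormZ_le a (f : clin) : opnorm (a *: f) <= `|a| * opnorm f.
Proof.
by apply: opnorm_le_ub => x x1; rewrite clinZE normrZ ler_wpM2l// opnorm_ub.
Qed.

Lemma opnormZ a (f : clin) : opnorm (a *: f) = `|a| * opnorm f.
Proof.
apply/eqP; rewrite eq_le opnormZ_le/=; have [->|a0] := eqVneq a 0.
  by rewrite normr0 mul0r opnorm_ge0.
rewrite -[X in _ * opnorm X](scalerK a0) mulrC -ler_pdivlMr ?normr_gt0//.
by rewrite mulrC -normfV opnormZ_le.
Qed.

Lemma opnorm0_eq0 (f : clin) : opnorm f = 0 -> f = 0.
Proof.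
move=> f0; apply/val_inj/funext => x /=; rewrite -[RHS]/(0 : F).
apply/eqP; rewrite -normr_le0; have [->|x0] := eqVneq x 0.
  by rewrite linear0 normr0.
have /(opnorm_ub f) : `| `|x|^-1 *: x| <= 1.
  by rewrite normrZ normfV normr_id mulVf// normr_eq0.
rewrite f0 linearZ/= normrZ normfV normr_id.
by rewrite pmulr_rle0// invr_gt0 normr_gt0.
Qed.

HB.instance Definition _ :=
  Lmodule_isNormed.Build R clin opnormD opnormZ opnorm0_eq0.

End ContinuousLinearMaps.

Definition npow (T : Type) (k : nat) : Type := {ffun 'I_k -> T}.

Section FinitePower.
Variables (R : realType) (E : normedModType R) (k : nat).

HB.instance Definition _ := GRing.Lmodule.on (npow E k).

Definition npow_norm (v : npow E k) : R := \big[Order.max/0]_(i < k) `|v i|.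

Lemma le_npow_norm (v : npow E k) i : `|v i| <= npow_norm v.
Proof. exact: le_bigmax. Qed.

Lemma npow_normD (u v : npow E k) :
  npow_norm (u + v) <= npow_norm u + npow_norm v.
Proof.
apply/bigmax_leP; split => [|i _].
  by rewrite addr_ge0//; apply: bigmax_ge_id.
by rewrite ffunE (le_trans (ler_normD _ _))// lerD// le_npow_norm.
Qed.

Lemma npow_normZ a (v : npow E k) : npow_norm (a *: v) = `|a| * npow_norm v.
Proof.
rewrite /npow_norm; elim/big_ind2: _ => [|x y z t -> ->|i _].
- by rewrite mulr0.
- by rewrite maxr_pMr.
- by rewrite ffunE normrZ.
Qed.

Lemma npow_norm0_eq0 (v : npow E k) : npow_norm v = 0 -> v = 0.
Proof.
move=> v0; apply/ffunP => i; apply/eqP; rewrite [X in _ == X]ffunE.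
by rewrite -normr_le0 -v0 le_npow_norm.
Qed.

HB.instance Definition _ :=
  Lmodule_isNormed.Build R (npow E k) npow_normD npow_normZ npow_norm0_eq0.

End FinitePower.

Section SmoothMaps.
Variables (R : realType) (E : normedModType R).

(* The Frechet derivative as a map [E -> L(E, F)]; it is [0] at the points
   where [f] is not differentiable with continuous linear differential. *)
Definition fderiv (F : normedModType R) (f : E -> F) (x : E) : clin E F :=
  insubd (0 : clin E F) ('d f x : E -> F).

Fixpoint Ck_on (n : nat) (F : normedModType R) (U : set E) (f : E -> F) : Prop :=
  match n with
  | 0 => forall x, U x -> {for x, continuous f}
  | n'.+1 => (forall x, U x -> differentiable f x) /\ Ck_on n' U (fderiv f)
  end.

Definition smooth_on (F : normedModType R) (U : set E) (f : E -> F) : Prop :=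
  forall n, Ck_on n U f.

End SmoothMaps.

Lemma fderivE (R : realType) (E F : normedModType R) (f : E -> F) (x : E) :
  differentiable f x -> fderiv f x = 'd f x :> (E -> F).
Proof.
move=> df; rewrite /fderiv insubdK//; apply/clin_predP; split.
  exact: linearP.
exact: diff_continuous.
Qed.

(* A set with a family of coordinate maps.  The atlas axioms are kept apart, in
   [manifold], so that the charts of a bundle can be introduced first. *)
Record charted (R : realType) (E : normedModType R) := Charted {
  carrier :> Type;
  chart_idx : Type;
  chart_dom : chart_idx -> set carrier;
  chart : chart_idx -> carrier -> E }.

Arguments chart_dom {R E c}.
Arguments chart {R E c}.

Section Charted.
Variable R : realType.

Definition model_charted (E : normedModType R) : charted E :=
  {| carrier := E; chart_idx := unit;
     chart_dom := fun _ => setT; chart := fun _ => id |}.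

Definition prod_charted (E F : normedModType R) (X : charted E) :
    charted (E * F)%type :=
  {| carrier := (X * F)%type; chart_idx := chart_idx X;
     chart_dom := fun a => [set p | chart_dom a p.1];
     chart := fun a p => (chart a p.1, p.2) |}.

(* [psi_b \o psi_a^-1] on [psi_a (U_a `&` U_b)], and [0] elsewhere *)
Definition transition (E : normedModType R) (X : charted E)
    (a b : chart_idx X) (y : E) : E :=
  xget 0 [set chart b x |
    x in chart_dom a `&` chart_dom b `&` chart a @^-1` [set y]].

(* [f] is smooth on the open set [A]: each [psi_b \o f \o psi_a^-1] is defined
   on an open set and agrees there with a map [g] smooth on that open set. *)
Definition smooth_map_on (E G : normedModType R) (X : charted E)
    (Y : charted G) (A : set X) (f : X -> Y) : Prop :=
  forall (a : chart_idx X) (b : chart_idx Y),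
    let D := A `&` chart_dom a `&` f @^-1` chart_dom b in
    open (chart a @` D) /\
    exists g : E -> G, smooth_on (chart a @` D) g /\
      forall x, D x -> chart b (f x) = g (chart a x).

Definition diffeo_on (E G : normedModType R) (X : charted E) (Y : charted G)
    (A : set X) (B : set Y) (f : X -> Y) : Prop :=
  smooth_map_on A f /\
  exists g : Y -> X, [/\ smooth_map_on B g,
    forall x, A x -> B (f x) /\ g (f x) = x &
    forall y, B y -> A (g y) /\ f (g y) = y].

End Charted.

Record manifold (R : realType) (E : normedModType R) := Manifold {
  man_charted :> charted E;
  chart_cover : forall x : man_charted, exists a, chart_dom a x;
  chart_inj : forall (a : chart_idx man_charted) x y,
    chart_dom a x -> chart_dom a y -> chart a x = chart a y -> x = y;
  chart_open : forall a b : chart_idx man_charted,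
    open (chart a @` (chart_dom a `&` chart_dom b));
  transition_smooth : forall a b : chart_idx man_charted,
    smooth_on (chart a @` (chart_dom a `&` chart_dom b)) (transition a b) }.

(* The topology of [M] is the one for which each [psi_a] is a homeomorphism of
   [U_a] onto its image. *)
Section ManifoldTopology.
Variables (R : realType) (E : normedModType R) (M : manifold E).

Definition man_open (W : set M) : Prop :=
  forall a : chart_idx M, open (chart a @` (W `&` chart_dom a)).

Lemma man_openT : man_open setT.
Proof.
by move=> a; rewrite setTI -[chart_dom a]setIid; exact: chart_open.
Qed.

Lemma man_openI : setI_closed man_open.
Proof.
move=> V W oV oW a.
suff -> : chart a @` (V `&` W `&` chart_dom a) =
    chart a @` (V `&` chart_dom a) `&` chart a @` (W `&` chart_dom a).
  exact: openI.
apply/seteqP; split => [_ [x [[Vx Wx] ax] <-]|y].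
  by split; exists x.
move=> [[x [Vx ax] <-] [z [Wz az] /(chart_inj az ax) zx]].
by exists x => //; split => //; split => //; rewrite -zx.
Qed.

Lemma man_open_bigU (I : Type) (W : I -> set M) :
  (forall i, man_open (W i)) -> man_open (\bigcup_i W i).
Proof.
move=> oW a; rewrite setI_bigcupl image_bigcup.
by apply: bigcup_open => i _; exact: oW.
Qed.

HB.instance Definition _ := gen_eqMixin (carrier M).
HB.instance Definition _ := gen_choiceMixin (carrier M).
HB.instance Definition _ :=
  isOpenTopological.Build (carrier M) man_openT man_openI man_open_bigU.

End ManifoldTopology.

Section PartitionOfUnity.
Variables (R : realType) (E : normedModType R) (M : manifold E).

Definition Ck_fun (k : nat) (f : M -> R) : Prop :=
  forall a : chart_idx M, exists g : E -> R^o,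
    Ck_on k (chart a @` chart_dom a) g /\
    forall x, chart_dom a x -> f x = g (chart a x).

Definition support_of (f : M -> R) : set M := closure [set x | f x != 0].

Definition Ck_partition_of_unity (k : nat) (J : choiceType)
    (O : J -> set M) (f : J -> M -> R) : Prop :=
  [/\ forall j, Ck_fun k (f j),
      forall j x, 0 <= f j x,
      forall j, support_of (f j) `<=` O j,
      forall x : M, exists2 W : set M, nbhs x W &
        finite_set [set j | W `&` support_of (f j) !=set0] &
      forall x, \sum_(j \in [set: J]) f j x = 1].

Definition Ck_partitionable (k : nat) : Prop :=
  forall (J : choiceType) (O : J -> set M),
    (forall j, open (O j)) -> \bigcup_j O j = setT ->
    exists f : J -> M -> R, Ck_partition_of_unity k O f.

End PartitionOfUnity.

Section HigherTangentBundles.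
Variables (R : realType) (E : normedModType R) (M : manifold E).

(* A curve [(-e, e) -> M] is represented by a total function whose values
   outside [(-e, e)] are irrelevant. *)
Definition smooth_curve (g : R -> M) : Prop :=
  exists2 e : R, 0 < e &
    smooth_map_on (X := model_charted R^o) (Y := M) [set t : R | - e < t < e] g.

Definition curve_at (x : M) : Type := {g : R -> M | smooth_curve g /\ g 0 = x}.

Definition curve_fun (x : M) (g : curve_at x) : R -> M := sval g.

(* Quantifying over all charts around [x] is the same as choosing one, by the
   chain rule. *)
Definition jet_equiv (k : nat) (x : M) (g h : curve_at x) : Prop :=
  forall a : chart_idx M, chart_dom a x ->
  forall j : nat, (1 <= j <= k)%N ->
    ((chart a \o curve_fun g)^`(j))%classic 0 =
    ((chart a \o curve_fun h)^`(j))%classic 0.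

Definition jet (k : nat) (x : M) : Type :=
  {C : set (curve_at x) | exists g, C = [set h | jet_equiv k g h]}.

Definition jet_class (k : nat) (x : M) (g : curve_at x) : jet k x :=
  exist _ [set h | jet_equiv k g h] (ex_intro _ g erefl).

Definition jet_repr (k : nat) (x : M) (u : jet k x) : R -> M :=
  curve_fun (sval (cid (svalP u))).

Definition jet_chart (k : nat) (a : chart_idx M) (u : {x : M & jet k x}) :
    E * npow E k :=
  let c := chart a \o jet_repr (tagged u) in
  (c 0, [ffun i : 'I_k => ((i.+1)`!%:R^-1 : R) *: (c^`(i.+1))%classic 0]).

Lemma jet_equiv_refl k x (g : curve_at x) : jet_equiv k g g.
Proof. by []. Qed.

Lemma jet_equiv_sym k x (g h : curve_at x) :
  jet_equiv k g h -> jet_equiv k h g.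
Proof. by move=> gh a ax j jk; rewrite gh. Qed.

Lemma jet_equiv_trans k x (g h l : curve_at x) :
  jet_equiv k g h -> jet_equiv k h l -> jet_equiv k g l.
Proof. by move=> gh hl a ax j jk; rewrite gh// hl. Qed.

Lemma jet_class_eq k x (g h : curve_at x) :
  jet_class k g = jet_class k h <-> jet_equiv k g h.
Proof.
split=> [[]/seteqP[_ /(_ h (@jet_equiv_refl k x h))]//|gh].
apply: eq_exist; apply/seteqP; split=> l /=; apply: jet_equiv_trans => //.
exact: jet_equiv_sym.
Qed.

(* The formula for [Psi_a^k [g, x]_k]: the choice made by [jet_repr] is
   irrelevant. *)
Lemma jet_chartE k (a : chart_idx M) x (g : curve_at x) : chart_dom a x ->
  jet_chart a (existT _ x (jet_class k g)) =
  ((chart a \o curve_fun g) 0,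
   [ffun i : 'I_k => ((i.+1)`!%:R^-1 : R) *:
      ((chart a \o curve_fun g)^`(i.+1))%classic 0]).
Proof.
move=> ax; rewrite /jet_chart /jet_repr /=; case: cid => h /= gh.
have /(_ a ax) e : jet_equiv k g h.
  have : [set l | jet_equiv k h l] h by exact: jet_equiv_refl.
  by rewrite -gh.
congr (_, _).
  by rewrite /comp /curve_fun (svalP g).2 (svalP h).2.
apply/ffunP => i; rewrite !ffunE; congr (_ *: _).
by apply/esym; exact: (e i.+1 (ltn_ord i)).
Qed.

Definition jet_bundle (k : nat) : charted (E * npow E k)%type :=
  {| carrier := {x : M & jet k x}; chart_idx := chart_idx M;
     chart_dom := fun a => [set u | chart_dom a (tag u)];
     chart := @jet_chart k |}.

Definition jet_proj (k : nat) (u : jet_bundle k) : M := tag u.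

(* Here [T_x M] is [jet 1 x]. *)
Definition whitney_coord (k : nat) (a : chart_idx M)
    (u : {x : M & 'I_k -> jet 1 x}) : npow E k :=
  [ffun i => ((chart a \o jet_repr (tagged u i))^`(1))%classic 0].

Definition whitney_sum (k : nat) : charted (E * npow E k)%type :=
  {| carrier := {x : M & 'I_k -> jet 1 x}; chart_idx := chart_idx M;
     chart_dom := fun a => [set u | chart_dom a (tag u)];
     chart := fun a u => (chart a (tag u), whitney_coord a u) |}.

Definition whitney_proj (k : nat) (u : whitney_sum k) : M := tag u.

End HigherTangentBundles.

(* Local trivializations [u |-> (p u, vb_coord i u)] over the sets [vb_dom i] *)
Record vb_atlas (R : realType) (E G : normedModType R) (M : manifold E)
    (X : charted G) (p : X -> M) (F : normedModType R) := VBAtlas {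
  vb_idx : Type;
  vb_dom : vb_idx -> set M;
  vb_coord : vb_idx -> X -> F }.

Section VectorBundles.
Variables (R : realType) (E : normedModType R) (M : manifold E).

Definition vector_bundle (G F : normedModType R) (X : charted G) (p : X -> M)
    (B : vb_atlas p F) : Prop :=
  [/\ smooth_map_on setT p,
      forall i : vb_idx B, open (vb_dom i),
      forall x, exists i : vb_idx B, vb_dom i x,
      forall i : vb_idx B,
        diffeo_on (Y := prod_charted F M) (p @^-1` vb_dom i)
          [set q | vb_dom i q.1] (fun u => (p u, vb_coord i u)) &
      forall i j : vb_idx B, exists A : M -> clin F F,
        smooth_map_on (Y := model_charted (clin F F))
          (vb_dom i `&` vb_dom j) A /\
        forall u, (vb_dom i `&` vb_dom j) (p u) ->
          vb_coord j u = A (p u) (vb_coord i u)].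

(* morphisms covering the identity of [M] *)
Definition vb_morphism (G1 F1 G2 F2 : normedModType R)
    (X1 : charted G1) (p1 : X1 -> M) (B1 : vb_atlas p1 F1)
    (X2 : charted G2) (p2 : X2 -> M) (B2 : vb_atlas p2 F2)
    (f : X1 -> X2) : Prop :=
  [/\ smooth_map_on setT f,
      forall u, p2 (f u) = p1 u &
      forall (i : vb_idx B1) (j : vb_idx B2), exists A : M -> clin F1 F2,
        smooth_map_on (Y := model_charted (clin F1 F2))
          (vb_dom i `&` vb_dom j) A /\
        forall u, (vb_dom i `&` vb_dom j) (p1 u) ->
          vb_coord j (f u) = A (p1 u) (vb_coord i u)].

Definition vb_isomorphic (G1 F1 G2 F2 : normedModType R)
    (X1 : charted G1) (p1 : X1 -> M) (B1 : vb_atlas p1 F1)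
    (X2 : charted G2) (p2 : X2 -> M) (B2 : vb_atlas p2 F2) : Prop :=
  exists (f : X1 -> X2) (g : X2 -> X1),
    [/\ vb_morphism B1 B2 f, vb_morphism B2 B1 g, cancel f g & cancel g f].

Definition whitney_atlas (k : nat) :
    vb_atlas (@whitney_proj R E M k) (npow E k) :=
  @VBAtlas R E _ M (whitney_sum M k) (@whitney_proj R E M k) (npow E k)
    (chart_idx M) (fun a => chart_dom a) (@whitney_coord R E M k).

End VectorBundles.

(* Continuous bilinear maps are the elements of [L(E, L(E, E))]. *)
Definition linear_connection (R : realType) (E : normedModType R)
    (M : manifold E) (Gam : chart_idx M -> E -> clin E (clin E E)) : Prop :=
  (forall a, smooth_on (chart a @` chart_dom a) (Gam a)) /\
  forall a b x, (chart a @` (chart_dom a `&` chart_dom b)) x ->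
    let psi := transition a b in
    forall v y : E,
      fderiv psi x (Gam a x v y) =
      fderiv (fderiv psi) x v y +
      Gam b (psi x) (fderiv psi x v) (fderiv psi x y).

(* Main.v *)
Require Import Defs.
From HB Require Import structures.
From mathcomp Require Import all_boot all_order all_algebra.
From mathcomp Require Import all_classical all_reals all_analysis.
From mathcomp Require Import ring.

(** A diffeomorphism [f] of [T^k M] onto the [k]-fold Whitney sum of [TM] that
preserves the fibres, with inverse [g], already determines a smooth linear
connection.

Near a zero jet, [T^k M] has a first-order structure that does not depend on
the chart: under a change of chart [psi] the first coordinate [w_1] of a jet is
multiplied by [D psi], while the reparametrizations [t |-> s t] of curves
multiply the coordinate [w_i] by [s ^ i], in every chart at once.
Differentiating [f] at [s = 0] along the reparametrized jets of a curve with
first coordinate [v] gives a vector [A v] of the Whitney sum that depends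
linearly on [v] only, and that transforms as a vector when the chart changes
([dfirst_transition]).

Let [sigma] be the image by [f] of the section of zero jets.  The curve
[t |-> g (sigma + t A v)] lies in one fibre of [T^k M], starts at the zero jet,
and its first coordinate has velocity [v] because [g] inverts [f] ([dGF]).  The
second coordinate changes by the law
[w_2' = D psi w_2 + 1/2 D^2 psi (w_1, w_1)] ([jet_chart_transition]), so two
derivatives in [t] at [0] produce exactly the term [D^2 psi (v, v)]: the
opposite of the second derivative of [w_2] along [sigma + t A v] obeys the
transformation law of a connection on the diagonal
([induced_connection_diag]).  Both sides of that law are symmetric bilinear
maps, since second derivatives are symmetric ([fderiv2_sym]), so polarization
gives the law for all pairs of vectors.

In charts the components are
[Gamma (x) (v, w) = - D^2 G_2 (sigma x) (A_x v, A_x w)], where [G_2] is the second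
jet coordinate of [g]; they are smooth because all the ingredients are.  This
needs the calculus of maps of class C^n between normed spaces: products,
composition, the mean value inequality and the symmetry of second
derivatives. *)

Set Implicit Arguments.
Unset Strict Implicit.
Unset Printing Implicit Defensive.

Import Order.TTheory GRing.Theory Num.Theory.
Import numFieldNormedType.Exports.

Local Open Scope classical_set_scope.
Local Open Scope ring_scope.

(** * Continuous linear and bilinear maps *)

Section ClinBasics.
Variable R : realType.
Implicit Types E F G H : normedModType R.

Definition mkclin E F (f : E -> F) (lf : linear f) (cf : continuous f) :
  clin E F := CLin (introT (clin_predP f) (conj lf cf)).

Lemma clin_bound_continuous E F (f : E -> F) (C : R) :
  linear f -> (forall x, `|f x| <= C * `|x|) -> continuous f.
Proof.
move=> lf fC; pose f' : {linear E -> F} :=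
  HB.pack f (GRing.isLinear.Build _ _ _ _ _ lf).
apply: (@bounded_linear_continuous _ _ _ f'); apply/linear_boundedP.
near=> r.
move=> x; rewrite (le_trans (fC x))// ler_wpM2r//.
Unshelve. all: by end_near. Qed.

Definition bounded_clin E F (f : E -> F) (C : R) (lf : linear f)
  (fC : forall x, `|f x| <= C * `|x|) : clin E F :=
  mkclin lf (clin_bound_continuous lf fC).

Lemma clin_ext E F (f g : clin E F) : (forall x, f x = g x) -> f = g.
Proof. by move=> fg; apply/val_inj/funext. Qed.

Lemma clin_le E F (f : clin E F) x : `|f x| <= `|f| * `|x|.
Proof.
have [->|x0] := eqVneq x 0; first by rewrite linear0 !normr0 mulr0.
have nx0 : 0 < `|x| by rewrite normr_gt0.
have /(opnorm_ub f) : `| `|x|^-1 *: x| <= 1.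
  by rewrite normrZ normfV normr_id mulVf ?gt_eqF.
rewrite linearZ/= normrZ normfV normr_id mulrC => fx.
by rewrite -ler_pdivrMr.
Qed.

Lemma clin_norm_le E F (f : clin E F) (C : R) : 0 <= C ->
  (forall x, `|f x| <= C * `|x|) -> `|f| <= C.
Proof.
move=> C0 fC; apply: opnorm_le_ub => x x1.
by rewrite (le_trans (fC x))// ler_piMr.
Qed.

Lemma near0_norm_le E (d : R) : 0 < d -> \forall h \near (0 : E), `|h| <= d.
Proof. exact: nbhs0_le. Qed.

Definition clin_id E : clin E E :=
  mkclin (fun a u v => erefl) (fun x => cvg_id).

Section Pairs.
Variables E F G : normedModType R.

Lemma clin_fst_continuous : continuous (fst : E * F -> E).
Proof. by move=> p; exact: cvg_fst. Qed.

Definition clin_fst : clin (E * F)%type E :=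
  mkclin (fun a u v => erefl) clin_fst_continuous.

Lemma clin_snd_continuous : continuous (snd : E * F -> F).
Proof. by move=> p; exact: cvg_snd. Qed.

Definition clin_snd : clin (E * F)%type F :=
  mkclin (fun a u v => erefl) clin_snd_continuous.

Lemma clin_pair_linear (K : clin G E) (L : clin G F) :
  linear (fun x => (K x, L x)).
Proof. by move=> a u v; rewrite !linearP. Qed.

Lemma clin_pair_continuous (K : clin G E) (L : clin G F) :
  continuous (fun x => (K x, L x)).
Proof.
move=> x; apply: cvg_pair; first exact: (@clin_continuous _ _ _ K).
exact: (@clin_continuous _ _ _ L).
Qed.

Definition clin_pair (K : clin G E) (L : clin G F) : clin G (E * F)%type :=
  mkclin (clin_pair_linear K L) (@clin_pair_continuous K L).

End Pairs.

Lemma clin_comp_linear E F G (g : clin F G) (f : clin E F) :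
  linear (g \o f).
Proof. by move=> a u v /=; rewrite !linearP. Qed.

Lemma clin_comp_continuous E F G (g : clin F G) (f : clin E F) :
  continuous (g \o f).
Proof.
by move=> x; apply: continuous_comp; apply: clin_continuous.
Qed.

Definition clin_comp E F G (g : clin F G) (f : clin E F) : clin E G :=
  mkclin (clin_comp_linear g f) (@clin_comp_continuous _ _ _ g f).

Lemma clin_comp_postlinear E F G (g : clin F G) :
  linear (clin_comp g : clin E F -> clin E G).
Proof. by move=> a u v; apply: clin_ext => x; exact: linearP. Qed.

Lemma clin_comp_le E F G (g : clin F G) (f : clin E F) :
  `|clin_comp g f| <= `|g| * `|f|.
Proof.
apply: clin_norm_le => [|x /=]; first by rewrite mulr_ge0.
rewrite (le_trans (clin_le _ _))// -mulrA ler_wpM2l//; exact: clin_le.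
Qed.

Definition clin_post E F G (g : clin F G) : clin (clin E F) (clin E G) :=
  bounded_clin (@clin_comp_postlinear E F G g) (@clin_comp_le E F G g).

Lemma clin_post_linear E F G :
  linear (@clin_post E F G : clin F G -> clin (clin E F) (clin E G)).
Proof. by move=> a u v; apply: clin_ext => f; apply: clin_ext. Qed.

Lemma clin_post_le E F G (g : clin F G) : `|@clin_post E F G g| <= 1 * `|g|.
Proof.
by rewrite mul1r; apply: clin_norm_le => // f; exact: clin_comp_le.
Qed.

(** Curried, so that the product rule for bilinear maps applies to compositions. *)
Definition clin_compose E F G : clin (clin F G) (clin (clin E F) (clin E G)) :=
  bounded_clin (@clin_post_linear E F G) (@clin_post_le E F G).

Section Flip.
Variables (F G H : normedModType R) (b : clin F (clin G H)).

Lemma clin_flip1_linear (y : G) : linear (fun x => b x y).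
Proof. by move=> a u v; rewrite linearP. Qed.

Lemma clin_flip1_le (y : G) x : `|b x y| <= `|b| * `|y| * `|x|.
Proof.
rewrite (le_trans (clin_le _ _))// mulrAC ler_wpM2r//; exact: clin_le.
Qed.

Definition clin_flip1 (y : G) : clin F H :=
  bounded_clin (clin_flip1_linear y) (clin_flip1_le y).

Lemma clin_flip_linear : linear (clin_flip1 : G -> clin F H).
Proof. by move=> a u v; apply: clin_ext => x; exact: linearP. Qed.

Lemma clin_flip_le y : `|clin_flip1 y| <= `|b| * `|y|.
Proof. by apply: clin_norm_le => [|x]; [rewrite mulr_ge0|exact: clin_flip1_le]. Qed.

Definition clin_flip : clin G (clin F H) :=
  bounded_clin clin_flip_linear clin_flip_le.

End Flip.

Definition clin_eval E F (x : E) : clin (clin E F) F := clin_flip1 (clin_id _) x.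

End ClinBasics.

(** * Frechet derivatives *)

Section HasFderiv.
Variable R : realType.
Implicit Types E F G H : normedModType R.

(** Differentiability and the value of [fderiv] are carried together, so that
the rules of calculus compose without side conditions. *)
Definition has_fderiv E F (f : E -> F) (x : E) (L : clin E F) : Prop :=
  differentiable f x /\ fderiv f x = L.

Lemma differentiable_has_fderiv E F (f : E -> F) x :
  differentiable f x -> has_fderiv f x (fderiv f x).
Proof. by []. Qed.

Lemma has_fderiv_is_diff E F (f : E -> F) x (L : clin E F) :
  has_fderiv f x L <-> is_diff x f L.
Proof.
split=> [[df <-]|[df dE]]; first by split=> //; rewrite fderivE.
by split=> //; apply: clin_ext => y; rewrite -dE fderivE.
Qed.

(** Unfolds the Landau notation of the definition of the differential; the
explicit estimate is what the proofs of locality, of the product rule and of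
the mean value inequality use. *)
Lemma has_fderivP E F (f : E -> F) x (L : clin E F) :
  has_fderiv f x L <->
  forall e : R, 0 < e ->
    \forall h \near (0 : E), `|f (h + x) - f x - L h| <= e * `|h|.
Proof.
split=> [|H].
  move/has_fderiv_is_diff => [df dE] e e0.
  have /diff_locally := df.
  move=> /eqaddoP/(_ e e0); apply: filterS => h /=.
  rewrite -dE; set A := (X in X <= _ -> _); set B := (X in _ -> X <= _).
  suff -> : A = B by [].
  by rewrite /A /B; congr (`| _ |); rewrite /= opprD addrA.
have fE : f \o shift x = cst (f x) + (L : E -> F) +o_ (0 : E) id.
  apply/eqaddoP => e e0; move: (H e e0); apply: filterS => h /=.
  set A := (X in X <= _ -> _); set B := (X in _ -> X <= _).
  suff -> : A = B by [].
  by rewrite /A /B; congr (`| _ |); rewrite /= opprD addrA.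
apply/has_fderiv_is_diff; have dE := diff_unique (@clin_continuous _ _ _ L) fE.
split=> //; apply/diff_locallyP; rewrite dE; split=> //.
exact: clin_continuous.
Qed.

Lemma has_fderiv_near E F (f g : E -> F) x (L : clin E F) :
  (\forall y \near x, f y = g y) -> has_fderiv f x L -> has_fderiv g x L.
Proof.
move=> fg /has_fderivP fL; apply/has_fderivP => e e0.
have fg0 : \forall h \near (0 : E), f (h + x) = g (h + x).
  by move: fg; rewrite (near_shift (0 : E) x) /=; apply: filterS => h /=; rewrite subr0.
have fgx : f x = g x := nbhs_singleton fg.
move: fg0 (fL e e0); apply: filterS2 => h fgh; by rewrite fgh fgx.
Qed.

Lemma has_fderiv_open E F (f g : E -> F) (U : set E) x (L : clin E F) :
  open U -> U x -> {in U, f =1 g} -> has_fderiv f x L -> has_fderiv g x L.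
Proof.
move=> oU Ux fg; apply: has_fderiv_near; near=> y.
by apply: fg; rewrite inE; near: y; exact: open_nbhs_nbhs.
Unshelve. all: by end_near. Qed.

Lemma has_fderiv_clin E F (L : clin E F) x : has_fderiv L x L.
Proof.
apply/has_fderivP => e e0; near=> h.
by rewrite linearD addrK subrr normr0 mulr_ge0// ltW.
Unshelve. all: by end_near. Qed.

Lemma has_fderiv_cst E F (c : F) (x : E) : has_fderiv (fun=> c) x 0.
Proof.
apply/has_fderivP => e e0; near=> h.
by rewrite subrr sub0r normrN normr0 mulr_ge0// ltW.
Unshelve. all: by end_near. Qed.

Lemma has_fderivD E F (f g : E -> F) x (K L : clin E F) :
  has_fderiv f x K -> has_fderiv g x L -> has_fderiv (fun y => f y + g y) x (K + L).
Proof.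
move=> /has_fderiv_is_diff fK /has_fderiv_is_diff gL.
by apply/has_fderiv_is_diff; exact: is_diffD.
Qed.

Lemma has_fderiv_comp E F G (g : F -> G) (f : E -> F) x
    (K : clin F G) (L : clin E F) :
  has_fderiv f x L -> has_fderiv g (f x) K ->
  has_fderiv (fun y => g (f y)) x (clin_comp K L).
Proof.
move=> /has_fderiv_is_diff fL /has_fderiv_is_diff gK.
by apply/has_fderiv_is_diff; exact: is_diff_comp.
Qed.

Lemma has_fderiv_continuous E F (f : E -> F) x (L : clin E F) :
  has_fderiv f x L -> {for x, continuous f}.
Proof. by case=> + _; exact: differentiable_continuous. Qed.

End HasFderiv.

Section Bilinear.
Variables (R : realType) (E F G H : normedModType R) (b : clin F (clin G H)).

(** The error term at increment [h] is exactly [b h.1 h.2], which is quadratic. *)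
Lemma clin_bilin_has_fderiv (p : F * G) :
  has_fderiv (fun q : F * G => b q.1 q.2) p
    (clin_comp (b p.1) (@clin_snd R F G) + clin_comp (clin_flip b p.2) (@clin_fst R F G)).
Proof.
apply/has_fderivP => e e0.
have d0 : 0 < e / (`|b| + 1) by rewrite divr_gt0// ltr_wpDl.
near=> h; rewrite clinDE /=.
have -> : b (h.1 + p.1) (h.2 + p.2) - b p.1 p.2 - (b p.1 h.2 + b h.1 p.2)
    = b h.1 h.2.
  rewrite (linearD b) clinDE 2!linearD addrA addrK.
  by rewrite (addrC (b p.1 h.2)) -(addrA (b h.1 h.2)) addrK.
rewrite (le_trans (clin_le _ _))//.
have b1 : `|b h.1| <= `|b| * `|h|.
  by rewrite (le_trans (clin_le _ _))// ler_wpM2l// prod_normE/= le_max lexx.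
rewrite (le_trans (ler_wpM2r _ b1))// ler_pM//; last first.
  by rewrite prod_normE/= le_max lexx orbT.
have : `|h| <= e / (`|b| + 1) by near: h; exact: (@near0_norm_le R (F * G)%type).
rewrite ler_pdivlMr ?ltr_wpDl//; apply: le_trans.
by rewrite mulrC ler_wpM2l// lerDl.
Unshelve. all: by end_near. Qed.

Lemma pair_has_fderiv (f : E -> F) (g : E -> G) x (K : clin E F) (L : clin E G) :
  has_fderiv f x K -> has_fderiv g x L ->
  has_fderiv (fun y => (f y, g y)) x (clin_pair K L).
Proof.
move=> /has_fderiv_is_diff fK /has_fderiv_is_diff gL.
by apply/has_fderiv_is_diff; exact: is_diff_pair.
Qed.

Lemma bilin_has_fderiv (f : E -> F) (g : E -> G) x (K : clin E F) (L : clin E G) :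
  has_fderiv f x K -> has_fderiv g x L ->
  has_fderiv (fun y => b (f y) (g y)) x
    (clin_comp (b (f x)) L + clin_comp (clin_flip b (g x)) K).
Proof.
move=> fK gL; have := has_fderiv_comp (pair_has_fderiv fK gL)
  (clin_bilin_has_fderiv (f x, g x)).
congr has_fderiv; exact: clin_ext.
Qed.

Lemma bilin_continuous (f : E -> F) (g : E -> G) x :
  {for x, continuous f} -> {for x, continuous g} ->
  {for x, continuous (fun y => b (f y) (g y))}.
Proof.
move=> cf cg; rewrite /prop_for /continuous_at.
apply: (@continuous_comp _ _ _ (fun y => (f y, g y)) (fun q : F * G => b q.1 q.2)).
  exact: cvg_pair.
exact: has_fderiv_continuous (clin_bilin_has_fderiv _).
Qed.

End Bilinear.

(** * Calculus of maps of class C^n *)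

Section CkCalculus.
Variables (R : realType) (E : normedModType R).
Implicit Types F G H : normedModType R.
Implicit Types U V : set E.

Lemma Ck_on_eq n F U (f g : E -> F) : open U ->
  (forall x, U x -> f x = g x) -> Ck_on n U f -> Ck_on n U g.
Proof.
elim: n F f g => [|n IH] F f g oU fg /=.
  move=> cf x Ux; rewrite /prop_for/continuous_at -fg//.
  apply: cvg_trans (cf x Ux); apply: near_eq_cvg; near=> y; apply: fg.
  by near: y; exact: open_nbhs_nbhs.
have fL x : U x -> differentiable f x -> has_fderiv g x (fderiv f x).
  move=> Ux df; apply: (has_fderiv_open oU Ux (f := f)) => // y.
  by rewrite inE; exact: fg.
move=> [df cdf]; split=> [x Ux|]; first by case: (fL x Ux (df x Ux)).
apply: (IH _ (fderiv f) (fderiv g) oU _ cdf) => x Ux.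
by have [_ ->] := fL x Ux (df x Ux).
Unshelve. all: by end_near. Qed.

Lemma Ck_on_sub n F U V (f : E -> F) : V `<=` U -> Ck_on n U f -> Ck_on n V f.
Proof.
elim: n F f => [|n IH] F f VU /=; first by move=> cf x /VU; exact: cf.
by move=> [df cdf]; split=> [x /VU|]; [exact: df|exact: IH cdf].
Qed.

Lemma Ck_on_pred n F U (f : E -> F) : Ck_on n.+1 U f -> Ck_on n U f.
Proof.
elim: n F f => [|n IH] F f [df cdf].
  by move=> x Ux; apply: differentiable_continuous; exact: df.
by split=> //; exact: IH.
Qed.

Lemma Ck_on_cst n F U (c : F) : Ck_on n U (fun=> c).
Proof.
elim: n F c => [|n IH] F c /=; first by move=> x _; exact: cst_continuous.
split=> [x _|]; first by case: (has_fderiv_cst c x).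
suff -> : fderiv (fun _ : E => c) = fun=> 0 by exact: IH.
by apply/funext => x; case: (has_fderiv_cst c x).
Qed.

Lemma Ck_on_clin n F U (L : clin E F) : Ck_on n U L.
Proof.
case: n => [|n]; first by move=> x _; exact: (@clin_continuous _ _ _ L).
split=> [x _|]; first by case: (has_fderiv_clin L x).
suff -> : fderiv L = fun=> L by exact: Ck_on_cst.
by apply/funext => x; case: (has_fderiv_clin L x).
Qed.

Lemma Ck_onD n F U (f g : E -> F) : open U ->
  Ck_on n U f -> Ck_on n U g -> Ck_on n U (fun x => f x + g x).
Proof.
elim: n F f g => [|n IH] F f g oU /=.
  by move=> cf cg x Ux; apply: continuousD; [exact: cf|exact: cg].
move=> [df cdf] [dg cdg].
have H x (Ux : U x) := has_fderivD
  (differentiable_has_fderiv (df x Ux)) (differentiable_has_fderiv (dg x Ux)).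
split=> [x Ux|]; first by case: (H x Ux).
by apply: Ck_on_eq (IH _ _ _ oU cdf cdg) => // x Ux; case: (H x Ux).
Qed.

(** By induction on the class, for all [b] at once: the derivative of
[b (f x) (g x)] is a sum of two terms of the same form, for the bilinear maps
[(f, g') |-> b f \o g'] and [(g, f') |-> b ^~ g \o f']. *)
Lemma Ck_on_bilin n F G H (b : clin F (clin G H)) U (f : E -> F) (g : E -> G) :
  open U -> Ck_on n U f -> Ck_on n U g -> Ck_on n U (fun x => b (f x) (g x)).
Proof.
elim: n F G H b f g => [|n IH] F G H b f g oU.
  by move=> cf cg x Ux; apply: bilin_continuous; [exact: cf|exact: cg].
move=> Cf Cg; have [df cdf] := Cf; have [dg cdg] := Cg.
have D x (Ux : U x) := bilin_has_fderiv b
  (differentiable_has_fderiv (df x Ux)) (differentiable_has_fderiv (dg x Ux)).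
split=> [x Ux|]; first by case: (D x Ux).
have Cfg := IH _ _ _ (clin_comp (clin_compose E G H) b) _ _ oU (Ck_on_pred Cf) cdg.
have Cgf := IH _ _ _ (clin_comp (clin_compose E F H) (clin_flip b)) _ _ oU
  (Ck_on_pred Cg) cdf.
apply: Ck_on_eq (Ck_onD oU Cfg Cgf) => // x Ux.
by have [_ ->] := D x Ux.
Qed.

Lemma smooth_on_fderiv F U (f : E -> F) : smooth_on U f -> smooth_on U (fderiv f).
Proof. by move=> sf n; have [] := sf n.+1. Qed.

Lemma smooth_on_has_fderiv F U (f : E -> F) x : smooth_on U f -> U x ->
  has_fderiv f x (fderiv f x).
Proof. by move=> sf Ux; have [df _] := sf 1%N; split=> //; exact: df. Qed.

End CkCalculus.

Section CkComp.
Variables (R : realType).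
Implicit Types E F G : normedModType R.

(** By induction on the class: the chain rule presents the derivative as the
composition, a continuous bilinear map, of [fderiv g \o f] and [fderiv f]. *)
Lemma Ck_on_comp n E F G (U : set E) (V : set F) (f : E -> F) (g : F -> G) :
  open U -> (forall x, U x -> V (f x)) ->
  Ck_on n U f -> Ck_on n V g -> Ck_on n U (fun x => g (f x)).
Proof.
move=> oU fUV; elim: n G g => [|n IH] G g.
  by move=> cf cg x Ux; apply: continuous_comp; [exact: cf|exact/cg/fUV].
move=> Cf Cg; have [df cdf] := Cf; have [dg cdg] := Cg.
have D x (Ux : U x) := has_fderiv_comp
  (differentiable_has_fderiv (df x Ux)) (differentiable_has_fderiv (dg _ (fUV x Ux))).
split=> [x Ux|]; first by case: (D x Ux).
have Cc := Ck_on_bilin (clin_compose E F G) oU (IH _ _ (Ck_on_pred Cf) cdg) cdf.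
by apply: Ck_on_eq Cc => // x Ux; have [_ ->] := D x Ux.
Qed.

End CkComp.

(** * Curves, and the symmetry of second derivatives *)

Section Curves.
Variable R : realType.
Implicit Types E F G H : normedModType R.

Lemma clin_line_linear F (v : F) : linear (fun t : R^o => t *: v).
Proof. by move=> a s t; rewrite scalerDl -scalerA. Qed.

Lemma clin_line_le F (v : F) (t : R^o) : `|t *: v| <= `|v| * `|t|.
Proof. by rewrite normrZ mulrC. Qed.

Definition clin_line F (v : F) : clin R^o F :=
  bounded_clin (clin_line_linear v) (clin_line_le v).

(** The velocity of a curve is recorded through its Frechet differential, so
that the rules for [has_fderiv] apply to curves. *)
Definition has_vel F (c : R -> F) (t : R) (v : F) : Prop :=
  has_fderiv (c : R^o -> F) t (clin_line v).

Lemma clin_lineE F (L : clin R^o F) : L = clin_line (L 1).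
Proof. by apply: clin_ext => t; rewrite -[t in LHS]mulr1 linearZ. Qed.

Lemma has_fderiv_vel F (c : R -> F) (t : R) (L : clin R^o F) :
  has_fderiv (c : R^o -> F) t L -> has_vel c t (L 1).
Proof. by rewrite /has_vel -clin_lineE. Qed.

Lemma has_velE F (c : R -> F) t v : has_vel c t v -> (c^`())%classic t = v.
Proof.
move=> [dc cE]; rewrite derive1E'// -fderivE// cE.
exact: scale1r.
Qed.

Lemma has_vel_uniq F (c : R -> F) t v w : has_vel c t v -> has_vel c t w -> v = w.
Proof. by move=> /has_velE <- /has_velE. Qed.

Lemma has_vel_near F (c d : R -> F) t v :
  (\forall s \near t, c s = d s) -> has_vel c t v -> has_vel d t v.
Proof. exact: (@has_fderiv_near R R^o). Qed.

Lemma has_vel_eq F (c : R -> F) t v w : has_vel c t v -> v = w -> has_vel c t w.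
Proof. by move=> cv <-. Qed.

Lemma has_vel_cst F (x : F) t : has_vel (fun=> x) t 0.
Proof.
have := has_fderiv_cst (x : F) (t : R^o); rewrite /has_vel.
by congr has_fderiv; apply: clin_ext => s; rewrite /= scaler0.
Qed.

Lemma has_vel_id t : has_vel (id : R -> R^o) t 1.
Proof.
rewrite /has_vel; apply/has_fderivP => e e0; near=> h.
by rewrite addrK /= /GRing.scale/= mulr1 subrr normr0 mulr_ge0// ltW.
Unshelve. all: by end_near. Qed.

Lemma has_velD F (c d : R -> F) t v w :
  has_vel c t v -> has_vel d t w -> has_vel (fun s => c s + d s) t (v + w).
Proof.
move=> cv dw; have := has_fderivD cv dw; congr has_fderiv.
by apply: clin_ext => s; rewrite /= scalerDr.
Qed.

Lemma has_vel_comp F G (g : F -> G) (c : R -> F) t v (L : clin F G) :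
  has_vel c t v -> has_fderiv g (c t) L -> has_vel (fun s => g (c s)) t (L v).
Proof.
move=> cv gL; have := has_fderiv_comp cv gL; congr has_fderiv.
by apply: clin_ext => s; rewrite /= linearZ.
Qed.

Lemma has_vel_clin F G (L : clin F G) (c : R -> F) t v :
  has_vel c t v -> has_vel (fun s => L (c s)) t (L v).
Proof. by move=> cv; apply: has_vel_comp (has_fderiv_clin L _). Qed.

Lemma has_vel_bilin F G H (b : clin F (clin G H)) (c : R -> F) (d : R -> G) t v w :
  has_vel c t v -> has_vel d t w ->
  has_vel (fun s => b (c s) (d s)) t (b (c t) w + b v (d t)).
Proof.
move=> cv dw; have := bilin_has_fderiv b cv dw; congr has_fderiv.
by apply: clin_ext => s; rewrite clinDE /= scalerDr !linearZ.
Qed.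

Lemma has_velZ F (k : R) (c : R -> F) t v :
  has_vel c t v -> has_vel (fun s => k *: c s) t (k *: v).
Proof.
move=> cv; have kl : linear ( *:%R k : F -> F).
  by move=> a x y; rewrite scalerDr !scalerA mulrC.
have kb (x : F) : `|k *: x| <= `|k| * `|x| by rewrite normrZ.
exact: (has_vel_clin (bounded_clin kl kb) cv).
Qed.

Lemma has_vel_line F (x v : F) t : has_vel (fun s => x + s *: v) t v.
Proof.
have := has_velD (has_vel_cst x t) (has_vel_clin (clin_line v) (has_vel_id t)).
by move/has_vel_eq; apply; rewrite /= scale1r add0r.
Qed.

Lemma has_vel_fst F G (c : R -> F * G) t v :
  has_vel c t v -> has_vel (fun s => (c s).1) t v.1.
Proof. exact: (has_vel_clin (clin_fst F G)). Qed.

Lemma has_vel_snd F G (c : R -> F * G) t v :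
  has_vel c t v -> has_vel (fun s => (c s).2) t v.2.
Proof. exact: (has_vel_clin (clin_snd F G)). Qed.

Lemma near_line F (U : set F) (x v : F) : open U -> U x ->
  \forall t \near (0 : R), U (x + t *: v).
Proof.
move=> oU Ux; have := has_fderiv_continuous (has_vel_line x v 0).
rewrite /prop_for /continuous_at scale0r addr0; apply.
exact: open_nbhs_nbhs.
Qed.

(** Mean value inequality, up to a slack that absorbs the error of
differentiability.  Let [m] be the supremum of the [t] with
[`|c t - c 0| <= K1 * t].  Across a small interval around [m] the curve moves at
rate at most [K1], so the bound passes from a [t] just below [m] to a point
above [m], or to [1] when [m = 1]; the former contradicts the choice of [m]. *)
Lemma vel_bound_lt F (c c' : R -> F) (K K1 : R) : K < K1 ->
  (forall t, 0 <= t <= 1 -> has_vel c t (c' t) /\ `|c' t| <= K) ->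
  `|c 1 - c 0| <= K1.
Proof.
move=> KK1 cK; pose S := [set t : R | 0 <= t <= 1 /\ `|c t - c 0| <= K1 * t].
have S0 : S 0 by split; [rewrite lexx ler01|rewrite subrr normr0 mulr0].
have Sub : has_sup S by split; [exists 0|exists 1 => t [/andP[]]].
set m := sup S.
have m0 : 0 <= m by exact: ub_le_sup Sub.2 _ S0.
have m1 : m <= 1 by apply: ge_sup => [|t [/andP[]]//]; exists 0.
have [/has_fderivP/(_ (K1 - K)) + c'm] := cK m (introT andP (conj m0 m1)).
rewrite subr_gt0 => /(_ KK1) /nbhs_norm0P[d /= d0 cd].
have cm (s : R) : `|s - m| < d -> `|c s - c m| <= K1 * `|s - m|.
  move=> /cd /=; rewrite subrK => h.
  rewrite -[c s - c m](subrK ((s - m) *: c' m)).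
  rewrite (le_trans (ler_normD _ _))// -[K1](subrK K) mulrDl lerD// normrZ.
  by rewrite mulrC ler_wpM2r.
have [t [t01 tS] mt] : exists2 t, S t & m - d < t.
  by apply: sup_adherent.
have tm : t <= m by apply: ub_le_sup => //; exact: Sub.2.
pose s := Num.min (m + d / 2) 1.
have ms : m <= s by rewrite le_min m1 andbT lerDl divr_ge0// ltW.
have sd : s - m < d.
  rewrite ltrBlDl (@le_lt_trans _ _ (m + d / 2))//; first by rewrite ge_min lexx.
  by rewrite ltrD2l ltr_pdivrMr// ltr_pMr// ltr1n.
(* the bounds on both sides of [m] add up, so [s] is again in [S] *)
have Ss : S s.
  split; first by rewrite (le_trans m0 ms) ge_min lexx orbT.
  have -> : c s - c 0 = (c s - c m) + (c m - c t) + (c t - c 0).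
    by rewrite subrKA subrKA.
  rewrite (le_trans (ler_normD _ _))//.
  have -> : K1 * s = K1 * (s - m) + K1 * (m - t) + K1 * t.
    by rewrite -!mulrDr subrKA subrK.
  rewrite lerD// (le_trans (ler_normD _ _))// lerD//.
    by have := cm s; rewrite ger0_norm ?subr_ge0//; apply.
  have := cm t; rewrite [`|t - m|]distrC [`|c t - _|]distrC ger0_norm ?subr_ge0//.
  by apply; rewrite ltrBlDl -ltrBlDr.
have : s <= m by apply: ub_le_sup Ss; exact: Sub.2.
have md : m + d / 2 <= m = false.
  by apply/negbTE; rewrite -ltNge ltrDl divr_gt0.
rewrite ge_min md /= => m1'.
have s1 : s = 1 by apply/eqP; rewrite eq_le ge_min lexx orbT (le_trans m1' ms).
by case: Ss; rewrite s1 mulr1.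
Qed.

Lemma vel_bound F (c c' : R -> F) (K : R) :
  (forall t, 0 <= t <= 1 -> has_vel c t (c' t) /\ `|c' t| <= K) ->
  `|c 1 - c 0| <= K.
Proof.
move=> cK; apply/ler_addgt0Pr => e e0; apply: vel_bound_lt cK.
by rewrite ltrDl.
Qed.

End Curves.

Section Symmetry.
Variables (R : realType) (E F : normedModType R) (f : E -> F) (U : set E) (x : E).
Hypotheses (oU : open U) (Ux : U x).
Hypothesis df : forall y, U y -> differentiable f y.
Hypothesis ddf : differentiable (fderiv f) x.

(** The second difference is the increment over [0 <= s <= 1] of
[s |-> f (x + t u + s t v) - f (x + s t v)]; the velocity of this curve is
[t^2 D^2 f (u, v)] up to [o (t^2)] by differentiability of [fderiv f] at [x],
and the mean value inequality transfers the estimate to the increment. *)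
Lemma second_difference_le (u v : E) (e : R) : 0 < e ->
  \forall t \near (0 : R),
  `|f (x + t *: u + t *: v) - f (x + t *: v) - f (x + t *: u) + f x
     - t ^+ 2 *: fderiv (fderiv f) x u v| <= e * t ^+ 2.
Proof.
move=> e0; set A := fderiv (fderiv f) x.
pose C := (`|u| + `|v| + `|v|) * `|v| + 1.
have C0 : 0 < C by rewrite ltr_wpDl// mulr_ge0// !addr_ge0.
have /has_fderivP/(_ (e / C)) := differentiable_has_fderiv ddf.
rewrite divr_gt0// => /(_ isT) H1.
have H2 : \forall h \near (0 : E), U (h + x).
  have : \forall y \near x, U y by exact: open_nbhs_nbhs.
  by rewrite (near_shift (0 : E) x); apply: filterS => h /=; rewrite subr0.
have [d /= d0 Hd] : exists2 d : R, 0 < d & forall h : E, `|h| < d ->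
   U (h + x) /\ `|fderiv f (h + x) - fderiv f x - A h| <= e / C * `|h|.
  have : \forall h \near (0 : E), U (h + x) /\
    `|fderiv f (h + x) - fderiv f x - A h| <= e / C * `|h| by exact: filterI H2 H1.
  by move=> /nbhs_norm0P[d d0 Hd]; exists d => // h /Hd.
pose B := `|u| + `|v| + 1.
have B0 : 0 < B by rewrite ltr_wpDl// addr_ge0.
(* [t] is small enough for all the points involved to stay in the ball of
   radius [d] on which the two properties collected in [Hd] hold *)
near=> t.
have tB : `|t| * (`|u| + `|v|) < d.
  have : `|t| <= d / B / 2.
    by near: t; apply: (@near0_norm_le R R^o); rewrite !divr_gt0.
  rewrite ler_pdivlMr// ler_pdivlMr// => tB.
  rewrite (@le_lt_trans _ _ (`|t| * B)) ?ler_wpM2l ?lerDl//.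
  have [->|t0] := eqVneq t 0; first by rewrite normr0 mul0r.
  rewrite (lt_le_trans _ tB)// mulrAC ltr_pMr ?ltr1n// mulr_gt0//.
  by rewrite normr_gt0.
pose c (s : R) := f ((x + t *: u) + s *: (t *: v)) + - 1 *: f (x + s *: (t *: v))
   + -1 *: (s *: (t ^+ 2 *: A u v)).
pose h1 (s : R) := t *: u + s *: (t *: v).
pose h2 (s : R) := s *: (t *: v).
pose c' s := fderiv f (h1 s + x) (t *: v) + -1 *: fderiv f (h2 s + x) (t *: v)
  + -1 *: (t ^+ 2 *: A u v).
have h2d s : 0 <= s <= 1 -> `|h2 s| <= `|t| * `|v|.
  move=> /andP[s0 s1]; rewrite /h2 !normrZ ger0_norm//.
  by rewrite ler_piMl// mulr_ge0.
have h1d s : 0 <= s <= 1 -> `|h1 s| <= `|t| * (`|u| + `|v|).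
  by move=> s01; rewrite (le_trans (ler_normD _ _))// normrZ mulrDr lerD2l h2d.
have h1E s : x + t *: u + s *: (t *: v) = h1 s + x.
  by rewrite [RHS]addrC /h1 addrA.
have h2E s : x + s *: (t *: v) = h2 s + x by rewrite addrC.
suff : `|c 1 - c 0| <= e * t ^+ 2.
  rewrite /c !scale1r !scale0r !addr0 !scaleN1r oppr0 addr0.
  rewrite opprB; congr (`| _ | <= _); rewrite !addrA.
  by rewrite addrAC -!addrA; congr (_ + (_ + _)); rewrite addrC addrA addrC.
apply: (@vel_bound _ _ c c') => s s01.
have h2lt : `|h2 s| < d.
  by rewrite (le_lt_trans (h2d _ s01))// (le_lt_trans _ tB)// ler_wpM2l// lerDr.
have h1lt : `|h1 s| < d by rewrite (le_lt_trans (h1d _ s01)).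
have [U1 D1] := Hd _ h1lt; have [U2 D2] := Hd _ h2lt; split.
  apply: has_velD; first apply: has_velD.
  - rewrite -h1E.
    apply: (has_vel_comp (has_vel_line _ _ _)).
    by rewrite h1E; apply: differentiable_has_fderiv; exact: df.
  - apply: has_velZ; rewrite -h2E.
    apply: (has_vel_comp (has_vel_line _ _ _)).
    by rewrite h2E; apply: differentiable_has_fderiv; exact: df.
  - apply: has_velZ; have := has_vel_line 0 (t ^+ 2 *: A u v) s.
    by apply: has_vel_near; near=> r; rewrite add0r.
have -> : c' s = ((fderiv f (h1 s + x) - fderiv f x - A (h1 s))
    - (fderiv f (h2 s + x) - fderiv f x - A (h2 s))) (t *: v).
  have h12 : A (h1 s) (t *: v) = A (h2 s) (t *: v) + t ^+ 2 *: A u v.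
    rewrite /h1 (linearD A) clinDE addrC; congr (_ + _).
    by rewrite (linearZ_LR A) clinZE linearZ/= scalerA expr2.
  have clinBE (K L : clin E F) w : (K - L) w = K w - L w by [].
  rewrite !clinBE h12 /c' !scaleN1r.
  rewrite (addrC (A (h2 s) _)) opprD addrA opprB opprB subrKA.
  by rewrite [in RHS]addrAC subrKA addrAC.
rewrite (le_trans (clin_le _ _))// normrZ.
have : `|(fderiv f (h1 s + x) - fderiv f x - A (h1 s))
    - (fderiv f (h2 s + x) - fderiv f x - A (h2 s))| <= e / C * (`|t| * (`|u| + `|v| + `|v|)).
  rewrite (le_trans (ler_normB _ _))// mulrDr mulrDr lerD//.
    by rewrite (le_trans D1)// ler_wpM2l ?h1d// divr_ge0 ?ltW.
  by rewrite (le_trans D2)// ler_wpM2l ?h2d// divr_ge0 ?ltW.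
move=> /(@ler_wpM2r _ (`|t| * `|v|)); rewrite mulr_ge0// => /(_ isT) /le_trans; apply.
rewrite -real_normK ?num_real// expr2.
rewrite [leLHS](_ : _ = (e / C * (C - 1)) * (`|t| * `|t|)); last first.
  have -> : C - 1 = (`|u| + `|v| + `|v|) * `|v| by rewrite addrK.
  by move: (e / C) => a; ring.
rewrite ler_wpM2r ?mulr_ge0// mulrAC ler_pdivrMr// ler_wpM2l ?ltW//.
by rewrite ltrBlDr ltrDl.
Unshelve. all: by end_near. Qed.

(** The second difference of [second_difference_le] is symmetric in [u] and
[v]. *)
Lemma fderiv2_sym (u v : E) :
  fderiv (fderiv f) x u v = fderiv (fderiv f) x v u.
Proof.
set A := fderiv (fderiv f) x; apply/eqP; rewrite -subr_eq0 -normr_le0.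
apply/ler_addgt0Pr => e e0; rewrite add0r.
have e20 : 0 < e / 2 by rewrite divr_gt0.
have second_diff_right (a b : E) : \forall t \near (0 : R)^'+,
  `|f (x + t *: a + t *: b) - f (x + t *: b) - f (x + t *: a) + f x
     - t ^+ 2 *: A a b| <= e / 2 * t ^+ 2.
  by apply: cvg_within; exact: second_difference_le.
near (0 : R)^'+ => t.
have t0 : 0 < t ^+ 2 by rewrite exprn_gt0.
have : `|f (x + t *: v + t *: u) - f (x + t *: u) - f (x + t *: v) + f x
     - t ^+ 2 *: A v u| <= e / 2 * t ^+ 2 by near: t.
have : `|f (x + t *: u + t *: v) - f (x + t *: v) - f (x + t *: u) + f x
     - t ^+ 2 *: A u v| <= e / 2 * t ^+ 2 by near: t.
rewrite (addrAC x (t *: v)); rewrite (addrAC _ (- f _) (- f _)); set W := _ - _ - _ + _.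
move=> h2 h1.
have : `|t ^+ 2 *: (A u v - A v u)| <= e * t ^+ 2.
  have -> : t ^+ 2 *: (A u v - A v u) = (W - t ^+ 2 *: A v u) - (W - t ^+ 2 *: A u v).
    by rewrite opprB [in RHS]addrC subrKA scalerBr.
  rewrite (le_trans (ler_normB _ _))// [e]splitr mulrDl lerD//.
by rewrite normrZ (ger0_norm (ltW t0)) mulrC ler_pM2r.
Unshelve. all: by end_near. Qed.

End Symmetry.

Lemma fderiv2_smooth_sym (R : realType) (V W : normedModType R) (h : V -> W)
    (U : set V) y u v :
  open U -> smooth_on U h -> U y ->
  fderiv (fderiv h) y u v = fderiv (fderiv h) y v u.
Proof.
move=> oU sh Uy; apply: (fderiv2_sym oU Uy) => [p Up|].
  by case: (smooth_on_has_fderiv sh Up).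
by case: (smooth_on_has_fderiv (smooth_on_fderiv sh) Uy).
Qed.

Lemma polarization_eq (R : realType) (E F : normedModType R)
    (A B : clin E (clin E F)) :
  (forall v w, A v w = A w v) -> (forall v w, B v w = B w v) ->
  (forall v, A v v = B v v) -> forall v w, A v w = B v w.
Proof.
move=> As Bs AB v w; have := AB (v + w).
rewrite (linearD A) (linearD B) !clinDE.
rewrite (linearD (A v)) (linearD (A w)) (linearD (B v)) (linearD (B w))/=.
rewrite !AB (As w) (Bs w) -!addrA => /addrI; rewrite !addrA => /addIr.
move=> e; have two_neq0 : (2 : R) != 0 by rewrite pnatr_eq0.
by apply: (scalerI two_neq0); rewrite !scaler_nat !mulr2n.
Qed.

(** * Finite powers, second velocities and pull-backs *)

Section FinitePowers.
Variables (R : realType) (k : nat).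
Implicit Types E F : normedModType R.

Lemma npow_norm_le E (v : npow E k) (C : R) : 0 <= C ->
  (forall i, `|v i| <= C) -> `|v| <= C.
Proof. by move=> C0 vC; apply/bigmax_leP; split => // i _; exact: vC. Qed.

Lemma npow_coord_linear E (i : 'I_k) : linear (fun v : npow E k => v i).
Proof. by move=> a u v; rewrite !ffunE. Qed.

Lemma npow_coord_le E (i : 'I_k) (v : npow E k) : `|v i| <= 1 * `|v|.
Proof. by rewrite mul1r; exact: le_npow_norm. Qed.

Definition npow_coord E (i : 'I_k) : clin (npow E k) E :=
  bounded_clin (@npow_coord_linear E i) (@npow_coord_le E i).

Definition npow_single E (i : 'I_k) (x : E) : npow E k :=
  [ffun j => if j == i then x else 0].

Lemma npow_single_linear E (i : 'I_k) : linear (@npow_single E i).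
Proof.
move=> a u v; apply/ffunP => j; rewrite !ffunE; case: eqP => // _.
by rewrite scaler0 addr0.
Qed.

Lemma npow_single_le E (i : 'I_k) (x : E) : `|npow_single i x| <= 1 * `|x|.
Proof.
rewrite mul1r; apply: npow_norm_le => // j.
by rewrite ffunE; case: eqP => // _; rewrite normr0.
Qed.

Definition npow_inj E (i : 'I_k) : clin E (npow E k) :=
  bounded_clin (@npow_single_linear E i) (@npow_single_le E i).

Section Diagonal.
Variables (E F : normedModType R) (T : clin E F).

Definition npow_map (v : npow E k) : npow F k := [ffun i => T (v i)].

Lemma npow_map_linear : linear npow_map.
Proof. by move=> a u v; apply/ffunP => i; rewrite !ffunE linearP. Qed.

Lemma npow_map_le v : `|npow_map v| <= `|T| * `|v|.
Proof.
apply: npow_norm_le => [|i]; first by rewrite mulr_ge0.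
by rewrite ffunE (le_trans (clin_le _ _))// ler_wpM2l// le_npow_norm.
Qed.

Definition clin_diag : clin (npow E k) (npow F k) :=
  bounded_clin npow_map_linear npow_map_le.

End Diagonal.

(** The effect on the coordinates of a jet of the reparametrization
[t |-> s t] of its curves; the index [i] stands for the derivative of order
[i.+1]. *)
Definition npow_rescale E (w : npow E k) (s : R) : npow E k :=
  [ffun i : 'I_k => s ^+ i.+1 *: w i].

(** All coordinates but the first vanish to second order in the factor. *)
Lemma npow_rescale_vel E (w : npow E k) (i0 : 'I_k) : i0 = 0%N :> nat ->
  has_vel (npow_rescale w) 0 (npow_inj E i0 (w i0)).
Proof.
move=> i00; rewrite /has_vel; apply/has_fderivP => e e0.
have d0 : 0 < Num.min (e / (`|w| + 1)) 1.
  by rewrite lt_min ltr01 divr_gt0// ltr_wpDl.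
near=> h.
have : `|h| <= Num.min (e / (`|w| + 1)) 1.
  by near: h; exact: (@near0_norm_le R R^o).
rewrite le_min ler_pdivlMr ?ltr_wpDl// => /andP[hw h1].
apply: npow_norm_le => [|i]; first by rewrite mulr_ge0// ltW.
rewrite !ffunE addr0 expr0n/= scale0r subr0.
case: eqP => [->|ii0]; first by rewrite i00 expr1 subrr normr0 mulr_ge0// ltW.
rewrite scaler0 subr0 normrZ normrX.
have i1 : (1 <= i)%N by rewrite lt0n -i00; apply/eqP => /val_inj.
rewrite exprS -mulrA mulrC.
apply: ler_wpM2r => //; apply: le_trans hw; rewrite (mulrC `|h|) (mulrC _ `|w i|).
apply: ler_pM => //.
  by rewrite (le_trans (le_npow_norm _ _))// lerDl.
by rewrite -(prednK i1) exprS ler_piMr// exprn_ile1.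
Unshelve. all: by end_near. Qed.

End FinitePowers.

Section PullBack.
Variable R : realType.
Implicit Types E F G X Y : normedModType R.

(** The pull-back [(v, w) |-> B (A v) (A w)], written as a composite in order to
inherit smoothness from the composition of continuous linear maps. *)
Definition clin_pull2 E X Y (B : clin X (clin X Y)) (A : clin E X) :
    clin E (clin E Y) :=
  clin_comp (clin_flip (clin_compose E X Y) A) (clin_comp B A).

Lemma smooth_on_pull2 E F X Y (U : set F) (B : F -> clin X (clin X Y))
    (A : F -> clin E X) :
  open U -> smooth_on U B -> smooth_on U A ->
  smooth_on U (fun x => clin_pull2 (B x) (A x)).
Proof.
move=> oU sB sA n; pose P : clin (clin E X) (clin (clin X Y) (clin E Y)) :=
  clin_flip (clin_compose E X Y).
have CP : Ck_on n U (fun x => P (A x)).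
  exact: (Ck_on_comp oU (V := setT) _ (sA n) (Ck_on_clin n setT P)).
have CBA := Ck_on_bilin (clin_compose E X (clin X Y)) oU (sB n) (sA n).
exact: (Ck_on_bilin (clin_compose E (clin X Y) (clin E Y)) oU CP CBA).
Qed.

(** The velocity of [c] is required on a set [I], to be an open neighbourhood of
[0], because a second derivative at [0] needs the first one around [0]. *)
Definition has_vel2 F (I : set R) (c : R -> F) (v : F) : Prop :=
  exists2 c' : R -> F, (forall t, I t -> has_vel c t (c' t)) & has_vel c' 0 v.

Lemma has_vel2_uniq F (I : set R) (c d : R -> F) v w : open I -> I 0 ->
  (forall t, I t -> c t = d t) ->
  has_vel2 I c v -> has_vel2 I d w -> v = w.
Proof.
move=> oI I0 cd [c' cc' c'v] [d' dd' d'w]; apply: has_vel_uniq d'w.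
apply: has_vel_near c'v; near=> t.
have It : I t by near: t; exact: open_nbhs_nbhs.
apply: has_vel_uniq (dd' _ It); apply: has_vel_near (cc' _ It).
by near=> s; apply: cd; near: s; exact: open_nbhs_nbhs.
Unshelve. all: by end_near. Qed.

Lemma has_vel2_line E F (H : E -> F) (U : set E) (s v : E) (I : set R) :
  I 0 -> (forall t, I t -> U (s + t *: v)) -> smooth_on U H ->
  has_vel2 I (fun t => H (s + t *: v)) (fderiv (fderiv H) s v v).
Proof.
move=> I0 IU sH; exists (fun t => fderiv H (s + t *: v) v) => [t It|].
  exact: has_vel_comp (has_vel_line _ _ _) (smooth_on_has_fderiv sH (IU _ It)).
have sU : U (s + 0 *: v) by exact: IU.
have := has_vel_comp (has_vel_line s v 0)
  (smooth_on_has_fderiv (smooth_on_fderiv sH) sU).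
rewrite scale0r addr0 => /(has_vel_clin (clin_eval F v)); exact.
Qed.

Lemma has_vel2_clin F G (L : clin F G) I (c : R -> F) v :
  has_vel2 I c v -> has_vel2 I (fun t => L (c t)) (L v).
Proof.
move=> [c' cc' c'v]; exists (fun t => L (c' t)); last exact: has_vel_clin.
by move=> t It; apply: has_vel_clin; exact: cc'.
Qed.

Lemma has_vel2D F I (c d : R -> F) v w :
  has_vel2 I c v -> has_vel2 I d w -> has_vel2 I (fun t => c t + d t) (v + w).
Proof.
move=> [c' cc' c'v] [d' dd' d'w]; exists (fun t => c' t + d' t).
  by move=> t It; apply: has_velD; [exact: cc'|exact: dd'].
exact: has_velD.
Qed.

(** Because [c 0 = 0], the terms that contain the second derivative of [c]
vanish. *)
Lemma has_vel2_quad F G (b : clin F (clin F G)) I (c : R -> F) v w : I 0 ->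
  has_vel2 I c w -> c 0 = 0 -> has_vel c 0 v ->
  has_vel2 I (fun t => 2^-1 *: b (c t) (c t)) (b v v).
Proof.
move=> I0 [c' cc' c'w] c0 cv.
have c'0 : c' 0 = v by apply: has_vel_uniq (cc' _ I0) cv.
exists (fun t => 2^-1 *: (b (c t) (c' t) + b (c' t) (c t))) => [t It|].
  by apply: has_velZ; apply: has_vel_bilin; exact: cc'.
have := has_velZ 2^-1 (has_velD (has_vel_bilin b cv c'w) (has_vel_bilin b c'w cv)).
move/has_vel_eq; apply; rewrite c0 c'0 !linear0 addr0 add0r.
by rewrite -mulr2n -(scaler_nat 2 (b v v)) scalerA mulVf ?scale1r// pnatr_eq0.
Qed.

End PullBack.

(** * Jets of curves in charts *)

Section SmoothCurves.
Variables (R : realType) (F : normedModType R).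
Implicit Types (p : R -> F) (U : set R^o).

Lemma smooth_on_vel p U t : smooth_on U (p : R^o -> F) -> U t ->
  has_vel p t ((p^`())%classic t).
Proof.
move=> sp Ut; have := has_fderiv_vel (smooth_on_has_fderiv sp Ut).
by move=> h; rewrite (has_velE h).
Qed.

Lemma smooth_on_derive1 p U : open U -> smooth_on U (p : R^o -> F) ->
  smooth_on U ((p^`())%classic : R^o -> F).
Proof.
move=> oU sp n; have dp := smooth_on_fderiv sp n.
have := Ck_on_comp oU (fun _ _ => I) dp (Ck_on_clin n setT (clin_eval F (1 : R^o))).
apply: Ck_on_eq => // t Ut.
by rewrite (has_velE (has_fderiv_vel (smooth_on_has_fderiv sp Ut))).
Qed.

Lemma smooth_on_derive1n n p U : open U -> smooth_on U (p : R^o -> F) ->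
  smooth_on U ((p^`(n))%classic : R^o -> F).
Proof. by move=> oU sp; elim: n => // n; exact: smooth_on_derive1. Qed.

Lemma derive1n_rescale n p U (s t : R) : open U -> smooth_on U (p : R^o -> F) ->
  U (s * t) ->
  ((fun r => p (s * r))^`(n))%classic t = s ^+ n *: (p^`(n))%classic (s * t).
Proof.
move=> oU sp; elim: n t => [|n IH] t Ut; first by rewrite expr0 scale1r.
have st : has_vel (fun r => s * r : R^o) t s.
  have := has_velZ s (has_vel_id t); move/has_vel_eq; apply.
  by rewrite /GRing.scale/= mulr1.
have oV : open ((fun r : R^o => s * r : R^o) @^-1` U).
  apply: open_comp => // r _.
  have := has_velZ s (has_vel_id r); exact: has_fderiv_continuous.
have := has_velZ (s ^+ n) (has_vel_comp st
  (smooth_on_has_fderiv (smooth_on_derive1n n oU sp) Ut)).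
rewrite (clin_lineE (fderiv _ _)) /= scalerA -exprSr.
rewrite -(has_velE (has_fderiv_vel (smooth_on_has_fderiv (smooth_on_derive1n n oU sp) Ut))).
move=> h; apply: has_velE; apply: has_vel_near h; near=> r.
rewrite -IH//; near: r; exact: open_nbhs_nbhs.
Unshelve. all: by end_near. Qed.

End SmoothCurves.

Section Jets.
Variables (R : realType) (E : normedModType R) (M : manifold E).
Implicit Types (a b : chart_idx M) (x : M).

Lemma transitionE a b x : chart_dom a x -> chart_dom b x ->
  transition a b (chart a x) = chart b x.
Proof.
move=> ax bx; rewrite /transition; case: xgetP => [y _ [z [[az bz] zx] <-]|].
  by rewrite (chart_inj az ax zx).
by move=> /(_ (chart b x))[]; exists x.
Qed.

(** The curve read in the chart agrees on an open set with a smooth map, and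
being of class C^n on an open set is a local property. *)
Lemma curve_smooth_on (c : R -> M) a : smooth_curve c -> chart_dom a (c 0) ->
  exists U : set R^o, [/\ open U, U 0, forall t, U t -> chart_dom a (c t) &
    smooth_on U (chart a \o c : R^o -> E)].
Proof.
move=> [e e0 sc] ac0; have [/=] := sc tt a; rewrite image_id.
set U := (X in open X) => oU [g [sg gE]]; exists U; split => //.
- by split=> //; split=> //=; rewrite oppr_lt0 e0.
- by move=> t [].
- by move=> n; apply: Ck_on_eq (sg n) => // t Ut; rewrite /= gE.
Qed.

(** The chain rule for [chart b \o c = psi \o (chart a \o c)], twice. *)
Lemma curve_transition (c : R -> M) a b (p := chart a \o c) (q := chart b \o c)
    (psi := transition a b) : smooth_curve c ->
  chart_dom a (c 0) -> chart_dom b (c 0) ->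
  (q^`(1))%classic 0 = fderiv psi (p 0) ((p^`(1))%classic 0) /\
  (q^`(2))%classic 0 = fderiv (fderiv psi) (p 0) ((p^`(1))%classic 0) ((p^`(1))%classic 0)
     + fderiv psi (p 0) ((p^`(2))%classic 0).
Proof.
move=> sc ac bc.
have [U [oU U0 aU sp]] := curve_smooth_on sc ac.
have [V [oV V0 bV sq]] := curve_smooth_on sc bc.
pose W := U `&` V; have oW : open W by exact: openI.
have W0 : W 0 by [].
have spsi := transition_smooth a b.
have pW t : W t -> (chart a @` (chart_dom a `&` chart_dom b)) (p t).
  by move=> [/aU at_ /bV bt]; exists (c t).
have qE t : W t -> psi (p t) = q t.
  by move=> [/aU at_ /bV bt]; exact: transitionE.
have qvel t : W t -> has_vel q t (fderiv psi (p t) ((p^`())%classic t)).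
  move=> Wt; have := has_vel_comp (smooth_on_vel sp Wt.1)
    (smooth_on_has_fderiv spsi (pW _ Wt)).
  apply: has_vel_near; near=> s; apply: qE; near: s; exact: open_nbhs_nbhs.
split; first exact: has_velE (qvel _ W0).
have pvel := smooth_on_vel sp U0.
have p'vel := smooth_on_vel (smooth_on_derive1 oU sp) U0.
have Dvel := has_vel_comp pvel (smooth_on_has_fderiv (smooth_on_fderiv spsi) (pW _ W0)).
have := has_vel_bilin (clin_id _) Dvel p'vel.
rewrite [X in has_vel _ _ X]addrC => h; apply: has_velE.
apply: has_vel_near h; near=> t; apply/esym/has_velE; apply: qvel.
near: t; exact: open_nbhs_nbhs.
Unshelve. all: by end_near. Qed.

Lemma jet_repr_smooth k x (u : jet k x) : smooth_curve (jet_repr u).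
Proof. exact: (svalP (sval (cid (svalP u)))).1. Qed.

Lemma jet_repr0 k x (u : jet k x) : jet_repr u 0 = x.
Proof. exact: (svalP (sval (cid (svalP u)))).2. Qed.

Lemma jet_chart1 k a x (u : jet k x) :
  (jet_chart a (existT _ x u)).1 = chart a x.
Proof. by rewrite /jet_chart/= jet_repr0. Qed.

Lemma const_curve_smooth x : smooth_curve (fun=> x).
Proof.
exists 1 => // -[] b /=; rewrite image_id.
have [bx|bx] := pselect (chart_dom b x).
  rewrite [X in open X](_ : _ = `]-1, 1[%classic); last first.
    apply/seteqP; split => t /=; first by move=> [[]]; rewrite in_itv.
    by rewrite in_itv/=; split.
  split; first exact: itv_open.
  by exists (fun=> chart b x); split => [n|//]; exact: Ck_on_cst.
rewrite [X in open X](_ : _ = set0); last by apply/seteqP; split => t // [].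
split; first exact: open0.
by exists (fun=> 0); split => [n|t []//]; exact: Ck_on_cst.
Qed.

Lemma rescaled_curve_smooth (c : R -> M) (s : R) : smooth_curve c -> `|s| <= 1 ->
  smooth_curve (fun t => c (s * t)).
Proof.
move=> [e e0 sc] s1; exists e => // -[] b.
have [/=] := sc tt b; rewrite !image_id; set D := (X in open X) => oD [g [sg gE]].
have st (t : R^o) : has_fderiv (fun r : R^o => s * r : R^o) t (clin_line (s : R^o)).
  have := has_velZ s (has_vel_id t); move/has_vel_eq; apply.
  by rewrite /GRing.scale/= mulr1.
have oI : open ([set t : R^o | - e < t < e]).
  rewrite [X in open X](_ : _ = `]-e, e[%classic); first exact: itv_open.
  by apply/seteqP; split => t /=; rewrite in_itv.
have oV : open ((fun r : R^o => s * r : R^o) @^-1` D).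
  by apply: open_comp => // r _; exact: has_fderiv_continuous (st r).
have E_ : [set t | - e < t < e] `&` setT `&` (fun t => c (s * t)) @^-1` chart_dom b =
    [set t : R^o | - e < t < e] `&` (fun r : R^o => s * r : R^o) @^-1` D.
  apply/seteqP; split => t.
    move=> [[et _] bt]; split => //; split => //; split => //=.
    move: et; rewrite /= -!ltr_norml normrM; apply: le_lt_trans.
    by rewrite ler_piMl.
  by move=> [et [_ bt]].
rewrite E_; split; first exact: openI.
exists (fun t => g (s * t)); split; last first.
  move=> t Dt; apply: gE; move: Dt; rewrite -[X in X -> _]/(([set t | - e < t < e] `&` setT
    `&` (fun t => c (s * t)) @^-1` chart_dom b) t) E_; by case.
move=> n; have slin : Ck_on n setT (clin_line (s : R^o)) by exact: Ck_on_clin.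
have := Ck_on_comp oV (V := D) _ (Ck_on_sub (@subsetT _ _) slin) (sg n).
move=> H; apply: (Ck_on_sub (@subIsetr _ _ _)).
apply: Ck_on_eq (H _) => // [t _|t]; first by rewrite /= /GRing.scale/= mulrC.
by rewrite /= /GRing.scale/= mulrC.
Qed.

End Jets.

(** * The coordinates of jets under rescaling and change of charts *)

Section JetBundle.
Variables (R : realType) (E : normedModType R) (M : manifold E) (k : nat).
Implicit Types (a b : chart_idx M) (x : M).

(** Reparametrizing a representative curve rescales the coordinates of its jet
in all charts simultaneously: this is what makes first-order information at
the zero jets independent of the chart. *)
Lemma jet_exists_scale a0 x (u : jet k x) (s : R) : `|s| <= 1 -> chart_dom a0 x ->
  exists v : jet k x, forall a, chart_dom a x ->
    jet_chart a (existT _ x v) =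
    (chart a x, npow_rescale (jet_chart a (existT _ x u)).2 s).
Proof.
move=> s1 a0x.
have cs : smooth_curve (fun t => jet_repr u (s * t)) /\ jet_repr u (s * 0) = x.
  split; first by apply: rescaled_curve_smooth => //; exact: jet_repr_smooth.
  by rewrite mulr0 jet_repr0.
exists (jet_class k (exist _ _ cs : curve_at x)) => a ax.
rewrite jet_chartE//=; congr (_, _); first by rewrite /curve_fun/= cs.2.
apply/ffunP => i; rewrite !ffunE scalerA mulrC -scalerA; congr (_ *: _).
have acx : chart_dom a (jet_repr u 0) by rewrite jet_repr0.
have [U [oU U0 _ sp]] := curve_smooth_on (jet_repr_smooth u) acx.
have := @derive1n_rescale _ _ i.+1 _ _ s 0 oU sp.
by rewrite mulr0; exact.
Qed.

Lemma const_jet_exists x : exists v : jet k x, forall a, chart_dom a x ->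
  jet_chart a (existT _ x v) = (chart a x, 0).
Proof.
pose g : curve_at x := exist _ _ (conj (const_curve_smooth x) erefl).
exists (jet_class k g) => a ax; rewrite jet_chartE//; congr (_, _).
apply/ffunP => i; rewrite !ffunE; apply/eqP; rewrite scaler_eq0; apply/orP; right.
have cst' (c : E) : ((fun=> c : E)^`())%classic = (fun=> 0) :> (R -> E).
  by apply/funext => t; exact: (@derive1_cst R E c t).
apply/eqP; rewrite derive1Sn (_ : chart a \o _ = fun=> chart a x)// cst'.
by elim: (i : nat) => // n IH; rewrite derive1Sn cst'.
Qed.

(** The first two derivatives of [psi \o c]; the factor [2^-1] comes from the
factorials in the coordinates of jets. *)
Lemma jet_chart_transition a b x (u : jet k x) (i0 i1 : 'I_k)
    (psi := transition a b)
    (w := (jet_chart a (existT _ x u)).2) (w' := (jet_chart b (existT _ x u)).2) :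
  i0 = 0%N :> nat -> i1 = 1%N :> nat -> chart_dom a x -> chart_dom b x ->
  w' i0 = fderiv psi (chart a x) (w i0) /\
  w' i1 = fderiv psi (chart a x) (w i1) +
    2^-1 *: fderiv (fderiv psi) (chart a x) (w i0) (w i0).
Proof.
move=> i00 i11 ax bx.
have ac : chart_dom a (jet_repr u 0) by rewrite jet_repr0.
have bc : chart_dom b (jet_repr u 0) by rewrite jet_repr0.
have := curve_transition (jet_repr_smooth u) ac bc.
rewrite [(chart a \o _) 0]/= jet_repr0 -/psi => -[e1 e2].
rewrite /w /w' /jet_chart /= !ffunE i00 i11 (_ : 1`! = 1%N)// (_ : 2`! = 2%N)//.
rewrite invr1 !scale1r; split => //.
by rewrite (linearZ_LR (fderiv psi _)) -scalerDr; congr (_ *: _); rewrite addrC; exact: e2.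
Qed.

Lemma whitney_coord_transition a b (z : whitney_sum M k) :
  chart_dom a (tag z) -> chart_dom b (tag z) ->
  whitney_coord b z = clin_diag k (fderiv (transition a b) (chart a (tag z)))
    (whitney_coord a z).
Proof.
case: z => x z /= ax bx; apply/ffunP => i; rewrite !ffunE/=.
have ac : chart_dom a (jet_repr (z i) 0) by rewrite jet_repr0.
have bc : chart_dom b (jet_repr (z i) 0) by rewrite jet_repr0.
have [+ _] := curve_transition (jet_repr_smooth (z i)) ac bc.
by rewrite [(chart a \o _) 0]/= jet_repr0.
Qed.

End JetBundle.

(** * The connection induced by a fibre-preserving diffeomorphism *)

Section InducedConnection.
Variables (R : realType) (E : normedModType R) (M : manifold E) (k : nat).
Variables (k2 : (1 < k)%N) (f : jet_bundle M k -> whitney_sum M k).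
Variable (g : whitney_sum M k -> jet_bundle M k).
Local Notation Z := (E * npow E k)%type.
Implicit Types (a b : chart_idx M) (x : M).

Definition wchart a (z : whitney_sum M k) : Z := (chart a (tag z), whitney_coord a z).

Definition jet_img a : set Z :=
  [set jet_chart a u | u in [set u : jet_bundle M k | chart_dom a (tag u)]].

Definition whitney_img a : set Z :=
  [set wchart a z | z in [set z : whitney_sum M k | chart_dom a (tag z)]].


(* [F a] and [G a] represent [f] and [g] in the charts of index [a]. *)
Variables F G : chart_idx M -> Z -> Z.

Hypothesis ft : forall u, tag (f u) = tag u.
Hypothesis gt : forall z, tag (g z) = tag z.
Hypothesis fgK : cancel f g.
Hypothesis oJ : forall a, open (jet_img a).
Hypothesis oW : forall a, open (whitney_img a).
Hypothesis sF : forall a, smooth_on (jet_img a) (F a).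
Hypothesis sG : forall a, smooth_on (whitney_img a) (G a).
Hypothesis FE : forall a u, chart_dom a (tag u) -> wchart a (f u) = F a (jet_chart a u).
Hypothesis GE : forall a z, chart_dom a (tag z) -> jet_chart a (g z) = G a (wchart a z).

Let i0 : 'I_k := Ordinal (ltnW k2).
Let i1 : 'I_k := Ordinal k2.

Definition first_coord_vec : clin E Z := clin_pair 0 (npow_inj E i0).

Definition zero_jet : clin E Z := clin_pair (clin_id E) 0.

(** The differential of [f], at the zero jet over the point of coordinate [y],
in the direction of a first jet coordinate. *)
Definition dfirst a (y : E) : clin E Z :=
  clin_comp (fderiv (F a) (zero_jet y)) first_coord_vec.

(** The sign turns the term [D^2 psi] of the law of second jet coordinates into
the one of the law of connections. *)
Definition neg_second_coord : clin Z E :=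
  - clin_comp (npow_coord E i1) (clin_snd E (npow E k)).

Definition neg_second_G a (z : Z) : E := neg_second_coord (G a z).

Definition induced_connection a (y : E) : clin E (clin E E) :=
  clin_pull2 (fderiv (fderiv (neg_second_G a)) (F a (zero_jet y))) (dfirst a y).

Lemma first_coord_vecE v : first_coord_vec v = (0, npow_inj E i0 v).
Proof. by []. Qed.

Lemma zero_jet_img a x : chart_dom a x -> jet_img a (zero_jet (chart a x)).
Proof.
move=> ax; have [v vE] := const_jet_exists k x.
by exists (existT _ x v) => //; rewrite vE.
Qed.

Lemma F_img a p : jet_img a p -> whitney_img a (F a p).
Proof.
by move=> [u au <-]; rewrite -FE//; exists (f u) => //; rewrite /= ft.
Qed.

Lemma neg_second_G_smooth a : smooth_on (whitney_img a) (neg_second_G a).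
Proof.
move=> n; exact: (Ck_on_comp (@oW a) (V := setT) (fun _ _ => Logic.I) (@sG a n)
    (Ck_on_clin n setT neg_second_coord)).
Qed.

Lemma chart_img_open a : open (chart a @` chart_dom a).
Proof. by have := chart_open a a; rewrite setIid. Qed.

Lemma induced_connection_smooth a :
  smooth_on (chart a @` chart_dom a) (induced_connection a).
Proof.
have oU := chart_img_open a.
have zJ y : (chart a @` chart_dom a) y -> jet_img a (zero_jet y).
  by move=> [x ax <-]; exact: zero_jet_img.
have szero n : Ck_on n (chart a @` chart_dom a) zero_jet by exact: Ck_on_clin.
apply: smooth_on_pull2 => // n.
- have sFz := Ck_on_comp oU zJ (szero n) (@sF a n).
  exact: (Ck_on_comp oU (fun y Uy => F_img (zJ y Uy)) sFz
    (smooth_on_fderiv (smooth_on_fderiv (@neg_second_G_smooth a)) n)).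
- have sDF := Ck_on_comp oU zJ (szero n) (smooth_on_fderiv (@sF a) n).
  pose P : clin (clin Z Z) (clin E Z) := clin_flip (clin_compose E Z Z) first_coord_vec.
  exact: (Ck_on_comp oU (V := setT) (fun _ _ => Logic.I) sDF (Ck_on_clin n setT P)).
Qed.

(** Rescaling a jet moves it to the zero jet along the direction of its first
coordinate. *)
Lemma rescaled_vel a x (u : jet k x) (w := (jet_chart a (existT _ x u)).2) :
  chart_dom a x ->
  has_vel (fun s => F a (chart a x, npow_rescale w s)) 0 (dfirst a (chart a x) (w i0)).
Proof.
move=> ax.
have r0 : npow_rescale w 0 = 0.
  by apply/ffunP => i; rewrite !ffunE expr0n/= scale0r.
have vel2 := pair_has_fderiv (has_vel_cst (chart a x) 0)
  (npow_rescale_vel w (erefl : i0 = 0%N :> nat)).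
have vel : has_vel (fun s => (chart a x, npow_rescale w s)) 0 (first_coord_vec (w i0)).
  move: vel2; rewrite /has_vel; congr has_fderiv; apply: clin_ext => t.
  by [].
apply: has_vel_comp vel _; rewrite r0.
exact: (smooth_on_has_fderiv (@sF a) (zero_jet_img ax)).
Qed.

(** For each [s] the images by [f] of the rescaled jet in the two charts are the
coordinates of one element of the Whitney sum over [x]; hence they correspond
under [D psi], and so do their velocities at [s = 0]. *)
Lemma dfirst_jet a b x (u : jet k x) :
  chart_dom a x -> chart_dom b x ->
  let w := (jet_chart a (existT _ x u)).2 in
  let w' := (jet_chart b (existT _ x u)).2 in
  (dfirst a (chart a x) (w i0)).1 = 0 /\
  (dfirst b (chart b x) (w' i0)).2 =
    clin_diag k (fderiv (transition a b) (chart a x)) (dfirst a (chart a x) (w i0)).2.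
Proof.
move=> ax bx w w'; have va := rescaled_vel u ax; have vb := rescaled_vel u bx.
have n1 : \forall s \near (0 : R), `|s| <= 1 by exact: (@near0_norm_le R R^o).
have FaE s : `|s| <= 1 -> exists z : whitney_sum M k, [/\ tag z = x,
    F a (chart a x, npow_rescale w s) = wchart a z &
    F b (chart b x, npow_rescale w' s) = wchart b z].
  move=> s1; have [v vE] := jet_exists_scale u s1 ax.
  exists (f (existT _ x v)).
  by rewrite ft -vE// -vE// !FE.
split.
  apply: has_vel_uniq (has_vel_fst va) _; apply: has_vel_near (has_vel_cst (chart a x) 0).
  by near=> s; have [|z [zx -> _]] := FaE s; [near: s|rewrite /= zx].
apply: has_vel_uniq (has_vel_snd vb) _.
apply: has_vel_near (has_vel_clin (clin_diag k _) (has_vel_snd va)).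
near=> s; have [|z [zx -> ->]] := FaE s; first by near: s.
by rewrite [RHS](whitney_coord_transition (a := a)) zx.
Unshelve. all: by end_near. Qed.

(** The chart image of the jets is open, so every vector [v] is, up to a
nonzero factor [t], the first coordinate of a jet; linearity removes [t]. *)
Lemma dfirst_transition a b x v : chart_dom a x -> chart_dom b x ->
  let T := fderiv (transition a b) (chart a x) in
  (dfirst a (chart a x) v).1 = 0 /\
  dfirst b (chart b x) (T v) = (0, clin_diag k T (dfirst a (chart a x) v).2).
Proof.
move=> ax bx T; have := near_line (first_coord_vec v) (@oJ a) (zero_jet_img ax).
move=> Jv; near (0 : R)^'+ => t.
have t0 : t != 0 by rewrite gt_eqF.
have [u au uE] : jet_img a (zero_jet (chart a x) + t *: first_coord_vec v).
  by near: t; apply: cvg_within.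
have /esym ux : tag u = x.
  apply: (chart_inj au ax); case: (u) uE => x' u' /(congr1 fst).
  by rewrite jet_chart1 /= scaler0 addr0.
case: u => x' u /= in au uE ux *; subst x'.
have w0 : (jet_chart a (existT _ x u)).2 i0 = t *: v.
  by rewrite uE /= !ffunE eqxx add0r.
have [w'0 _] := jet_chart_transition u (erefl : i0 = 0%N :> nat)
  (erefl : i1 = 1%N :> nat) ax bx.
(* applying the first part with the charts exchanged handles the base component
   in the chart [b] *)
have [A1 A2] := dfirst_jet u ax bx; have [B1 _] := dfirst_jet u bx ax.
have DZ a' y (c : R) u' : dfirst a' y (c *: u') = c *: dfirst a' y u'.
  exact: linearZ_LR.
have TZ : T (t *: v) = t *: T v by exact: linearZ_LR.
have dZ (c : R) w : clin_diag k T (c *: w) = c *: clin_diag k T w.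
  exact: linearZ_LR.
have eA := etrans (congr1 (dfirst a (chart a x)) w0) (DZ a (chart a x) t v).
have eB := etrans (congr1 (dfirst b (chart b x)) (etrans w'0 (etrans (congr1 T w0) TZ)))
  (DZ b (chart b x) t (T v)).
have cancel_t (V : lmodType R) (p q : V) : t *: p = t *: q -> p = q.
  by move/(scalerI t0).
have {}A1 : (dfirst a (chart a x) v).1 = 0.
  by apply: cancel_t; rewrite scaler0; exact: etrans (congr1 fst (esym eA)) A1.
have {}B1 : (dfirst b (chart b x) (T v)).1 = 0.
  by apply: cancel_t; rewrite scaler0; exact: etrans (congr1 fst (esym eB)) B1.
have {}A2 : (dfirst b (chart b x) (T v)).2 = clin_diag k T (dfirst a (chart a x) v).2.
  apply: cancel_t; rewrite -dZ; apply: etrans (congr1 snd (esym eB)) _.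
  exact: etrans A2 (congr1 (fun z : Z => clin_diag k T z.2) eA).
split; first exact: A1.
by rewrite [LHS]surjective_pairing B1 A2.
Unshelve. all: by end_near. Qed.

Lemma F_zero_jet a b x : chart_dom a x -> chart_dom b x ->
  exists z : whitney_sum M k,
  [/\ tag z = x, F a (zero_jet (chart a x)) = wchart a z &
      F b (zero_jet (chart b x)) = wchart b z].
Proof.
move=> ax bx; have [v vE] := const_jet_exists k x.
exists (f (existT _ x v)); split; first by rewrite ft.
  by rewrite FE// vE.
by rewrite FE// vE.
Qed.

Lemma GFK a p : jet_img a p -> G a (F a p) = p.
Proof. by move=> [u au <-]; rewrite -FE// -GE ?fgK// ft. Qed.

(** The chain rule for [G \o F = id] at a zero jet. *)
Lemma dGF a y v : jet_img a (zero_jet y) ->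
  fderiv (G a) (F a (zero_jet y)) (dfirst a y v) = first_coord_vec v.
Proof.
move=> Jy; have dF := smooth_on_has_fderiv (@sF a) Jy.
have dG := smooth_on_has_fderiv (@sG a) (F_img Jy).
have H1 := has_fderiv_comp dF dG.
have H2 : has_fderiv (fun p => G a (F a p)) (zero_jet y) (clin_id Z).
  apply: (has_fderiv_open (@oJ a) Jy (f := id)).
    by move=> p; rewrite inE => Jp; rewrite GFK.
  exact: (has_fderiv_clin (clin_id Z)).
by have := etrans (esym H1.2) H2.2 => /(congr1 (fun L : clin Z Z => L (first_coord_vec v))).
Qed.

(** For small [t], [sa + t A] and [sb + t B] are the coordinates in the charts
[a] and [b] of one element of the Whitney sum, and its image by [g] is one jet.
Its second coordinates in both charts are related by [jet_chart_transition];
the identity is the second derivative at [t = 0] of that relation. *)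
Lemma induced_connection_diag a b x v : chart_dom a x -> chart_dom b x ->
  let psi := transition a b in
  let T := fderiv psi (chart a x) in
  T (induced_connection a (chart a x) v v) =
  fderiv (fderiv psi) (chart a x) v v + induced_connection b (chart b x) (T v) (T v).
Proof.
move=> ax bx psi T.
set sa := F a (zero_jet (chart a x)); set sb := F b (zero_jet (chart b x)).
set A := dfirst a (chart a x) v; set B := dfirst b (chart b x) (T v).
have [z0 [z0x saE sbE]] : exists z : whitney_sum M k,
  [/\ tag z = x, sa = wchart a z & sb = wchart b z] := F_zero_jet ax bx.
have [A1 BE] := dfirst_transition v ax bx.
pose I := [set t : R | whitney_img a (sa + t *: A)].
have oI : open I.
  apply: (@open_comp _ _ (fun t : R^o => sa + t *: A) (whitney_img a)) => // t _.
  exact: has_fderiv_continuous (has_vel_line sa A t).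
have Jz := zero_jet_img ax.
have I0 : I 0 by rewrite /I /= scale0r addr0; exact: F_img.
have zt t : I t -> exists z : whitney_sum M k,
    [/\ tag z = x, sa + t *: A = wchart a z & sb + t *: B = wchart b z].
  move=> [z az zE]; exists z.
  have zx : tag z = x.
    apply: (chart_inj az ax); move/(congr1 fst): zE => /= ->.
    by rewrite A1 scaler0 addr0 saE /= z0x.
  split => //; rewrite /B BE sbE; congr (_, _); rewrite /= ?scaler0 ?addr0 ?z0x ?zx//.
  rewrite [RHS](whitney_coord_transition (a := a)) ?zx//.
  rewrite (whitney_coord_transition (a := a)) ?z0x// -/psi -/T.
  have -> : whitney_coord a z = whitney_coord a z0 + t *: A.2.
    by move/(congr1 snd): zE => /= ->; rewrite saE.
  rewrite [RHS](linearD (clin_diag k T)).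
  by congr (_ + _); rewrite [RHS](linearZ_LR (clin_diag k T)).
(* [P] is the first coordinate of the jet: [P 0 = 0] and [P' 0 = v]. *)
pose P t := (G a (sa + t *: A)).2 i0.
have PE : forall t, I t -> T (neg_second_G a (sa + t *: A)) =
    2^-1 *: fderiv (fderiv psi) (chart a x) (P t) (P t) + neg_second_G b (sb + t *: B).
  move=> t /zt[z [zx zaE zbE]].
  rewrite /P /neg_second_G zaE zbE -GE ?zx// -GE ?zx//.
  have gzx : tag (g z) = x by rewrite gt.
  case: (g z) gzx => x' u /= x'x; subst x'.
  have [_ e] := jet_chart_transition u (erefl : i0 = 0%N :> nat)
    (erefl : i1 = 1%N :> nat) ax bx.
  have e2 : T (- (jet_chart a (existT _ x u)).2 i1) =
      2^-1 *: fderiv (fderiv psi) (chart a x) ((jet_chart a (existT _ x u)).2 i0)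
        ((jet_chart a (existT _ x u)).2 i0) - (jet_chart b (existT _ x u)).2 i1.
    by rewrite e (linearN T) opprD [RHS]addrC subrK.
  exact: e2.
pose p0 : clin Z E := clin_comp (npow_coord E i0) (clin_snd E (npow E k)).
have sP n : Ck_on n (whitney_img a) (fun z => p0 (G a z)).
  exact: (Ck_on_comp (@oW a) (V := setT) (fun _ _ => Logic.I) (@sG a n)
    (Ck_on_clin n setT p0)).
have P0 : P 0 = 0 by rewrite /P scale0r addr0 GFK //= ffunE.
have Pv : has_vel P 0 v.
  have sW : whitney_img a (sa + 0 *: A) by exact: I0.
  have := has_vel_clin p0 (has_vel_comp (has_vel_line sa A 0)
    (smooth_on_has_fderiv (@sG a) sW)).
  rewrite scale0r addr0 dGF// => /has_vel_eq; apply.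
  by rewrite first_coord_vecE /= ffunE eqxx.
have IB t : I t -> whitney_img b (sb + t *: B).
  by move=> /zt[z [zx _ ->]]; exists z => //=; rewrite zx.
have L := has_vel2_clin T (has_vel2_line I0 (fun t It => It) (@neg_second_G_smooth a)).
have RQ := has_vel2_quad (fderiv (fderiv psi) (chart a x)) I0
  (has_vel2_line I0 (fun t It => It) sP) P0 Pv.
have RG := has_vel2_line I0 IB (@neg_second_G_smooth b).
exact: has_vel2_uniq oI I0 PE L (has_vel2D RQ RG).
Qed.

Lemma induced_connection_sym a x v w : chart_dom a x ->
  induced_connection a (chart a x) v w = induced_connection a (chart a x) w v.
Proof.
move=> ax; apply: (fderiv2_smooth_sym _ _ (@oW a) (@neg_second_G_smooth a)).
by apply: F_img; exact: zero_jet_img.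
Qed.

(** The law holds on the diagonal and both of its sides are symmetric. *)
Lemma induced_connection_linear : linear_connection induced_connection.
Proof.
split; first exact: induced_connection_smooth.
move=> a b _ [x [ax bx] <-] psi v w; rewrite (transitionE ax bx : psi (chart a x) = chart b x).
set T := fderiv psi (chart a x).
pose A : clin E (clin E E) :=
  clin_comp (clin_post E T) (induced_connection a (chart a x)).
pose B : clin E (clin E E) := fderiv (fderiv psi) (chart a x)
  + clin_pull2 (induced_connection b (chart b x)) T.
apply: (@polarization_eq _ _ _ A B) => [u1 u2|u1 u2|u].
- exact: (congr1 T (induced_connection_sym u1 u2 ax)).
- have psi_sym := fderiv2_smooth_sym u1 u2 (chart_open a b) (transition_smooth a b)
    (imageP (chart a) (conj ax bx)).
  exact: (congr2 (fun p q : E => p + q) psi_sym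
    (induced_connection_sym (T u1) (T u2) bx)).
- exact: induced_connection_diag.
Qed.

End InducedConnection.

Theorem theorem3p6 (R : realType) (E : completeNormedModType R)
  (M : manifold E) (k : nat) (k_ge2 : (2 <= k)%N)
  (M_part : Ck_partitionable M k) :
  (exists (F : completeNormedModType R) (B : vb_atlas (@jet_proj R E M k) F),
     vector_bundle B /\ vb_isomorphic B (whitney_atlas M k)) ->
  exists Gam : chart_idx M -> E -> clin E (clin E E), linear_connection Gam.
Proof.
move=> [V [B [_ [f [g [[sf ft _] [sg gt _] fgK _]]]]]].
(* The chart images are open, and local representatives exist, by smoothness of
   [f] and [g] for a pair of charts of the same index: since [f] and [g] cover
   the identity, the domain is then the whole domain of the chart. *)
have repf a : exists F : E * npow E k -> E * npow E k,
    [/\ open (@jet_img R E M k a), smooth_on (@jet_img R E M k a) F &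
    forall u, chart_dom a (tag u) -> wchart a (f u) = F (jet_chart a u)].
  have [] := sf a a; set D := _ `&` _.
  have -> : D = [set u : jet_bundle M k | chart_dom a (tag u)].
    apply/seteqP; split => u; first by move=> [[]].
    by move=> au; split => //; rewrite /= [tag (f u)]ft.
  by move=> oD [F [sF FE]]; exists F; split.
have repg a : exists G : E * npow E k -> E * npow E k,
    [/\ open (@whitney_img R E M k a), smooth_on (@whitney_img R E M k a) G &
    forall z, chart_dom a (tag z) -> jet_chart a (g z) = G (wchart a z)].
  have [] := sg a a; set D := _ `&` _.
  have -> : D = [set u : whitney_sum M k | chart_dom a (tag u)].
    apply/seteqP; split => u; first by move=> [[]].
    by move=> au; split => //; rewrite /= [tag (g u)]gt.
  by move=> oD [G [sG GE]]; exists G; split.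
have [F hF] := choice repf; have [G hG] := choice repg.
exists (induced_connection k_ge2 F G).
apply: (@induced_connection_linear R E M k k_ge2 f g F G) => // a.
- by have [] := hF a.
- by have [] := hG a.
- by have [] := hF a.
- by have [] := hG a.
- by have [] := hF a.
- by have [] := hG a.
Qed.
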